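(* Let $(X,\mathcal{B})$ be an uncountable standard Borel space, and let $Aut_0(X,\mathcal{B})=Aut(X,\mathcal{B})/Ctbl(X)$ be endowed with the quotient topology $\tau_0$ of the uniform topology $\tau$. Then the topological group $(Aut_0(X,\mathcal{B}),\tau_0)$ is path-connected.
   Context: $Aut(X,\mathcal{B})$ is the group of all Borel automorphisms of $(X,\mathcal{B})$ (bijections $T:X\to X$ with $T,T^{-1}$ Borel). For $S,T\in Aut(X,\mathcal{B})$ let $E(S,T)=\{x\in X: Tx\ne Sx\}\cup\{x\in X: S^{-1}x\neq T^{-1}x\}$. The topology $\tau$ on $Aut(X,\mathcal{B})$ is defined by the base of neighborhoods $U(T;\mu_1,\ldots,\mu_n;\varepsilon)=\{S\in Aut(X,\mathcal{B}) : \mu_i(E(S,T))<\varepsilon,\ i=1,\ldots,n\}$, where $T\in Aut(X,\mathcal{B})$, $n\in\mathbb{N}$, $\mu_1,\ldots,\mu_n$ are Borel probability measures on $X$, and $\varepsilon>0$. $Ctbl(X)$ is the normal subgroup of all $T\in Aut(X,\mathcal{B})$ with countable support, i.e. such that $\{x\in X: Tx\neq x\}$ is at most countable. $\tau_0$ is the quotient topology on $Aut_0(X,\mathcal{B})$ induced by $\tau$. *)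

(* Defs.v *)
From HB Require Import structures.
From mathcomp Require Import all_boot all_order all_algebra generic_quotient.
From mathcomp Require Import all_classical all_reals all_analysis.

Set Implicit Arguments.
Unset Strict Implicit.
Unset Printing Implicit Defensive.
Import Order.TTheory GRing.Theory Num.Theory.
Import numFieldNormedType.Exports.

Local Open Scope classical_set_scope.
Local Open Scope ring_scope.

(* A path is a function on the whole line of which only the restriction to
   the unit interval matters. *)
Definition path_connected (R : realType) (T : topologicalType) : Prop :=
  forall x y : T, exists f : R -> T,
    [/\ {within `[0, 1], continuous f}, f 0 = x & f 1 = y].

HB.mixin Record isTopologicalGroup G & Group G & Topological G := {
  mulg_continuous : continuous (fun xy : G * G => (xy.1 * xy.2)%g);
  invg_continuous : continuous (fun x : G => (x^-1)%g)
}.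

#[short(type="topologicalGroupType")]
HB.structure Definition TopologicalGroup :=
  {G of Group G & Topological G & isTopologicalGroup G}.

Definition complete_space (M : uniformType) : Prop :=
  forall F : set_system M, ProperFilter F -> cauchy F ->
    exists l : M, F --> l.

Definition separable_space (T : topologicalType) : Prop :=
  exists2 D : set T, countable D & dense D.

(* The measurable sets are the Borel sets of a Polish topology, given by a
   bijection f with a complete separable metric space M. *)
HB.mixin Record isStandardBorel (R : realType) d X & Measurable d X := {
  standard_borel : exists (M : metricType R) (f : X -> M),
    [/\ complete_space M, separable_space M, bijective f
      & @measurable d X = preimage_set_system setT f <<s @open M >>]
}.

#[short(type="standardBorelType")]
HB.structure Definition StandardBorel (R : realType) d :=
  {X of Measurable d X & isStandardBorel R d X}.

Record aut d (X : measurableType d) := Aut {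
  aut_fun :> X -> X;
  aut_inv : X -> X;
  aut_funK : cancel aut_fun aut_inv;
  aut_invK : cancel aut_inv aut_fun;
  measurable_aut_fun : measurable_fun setT aut_fun;
  measurable_aut_inv : measurable_fun setT aut_inv
}.

Lemma mulVg_conj (G : groupType) (x y z t : G) :
  ((x * y)^-1 * (z * t) = (x^-1 * z) ^ y * (y^-1 * t))%g.
Proof. by rewrite conjgE invgM !mulgA mulgK. Qed.

Lemma mulgV_conj (G : groupType) (x y : G) :
  (x * y^-1 = ((x^-1 * y)^-1) ^ x^-1)%g.
Proof. by rewrite conjgE invgM !invgK mulgK. Qed.

Section aut_group.
Context d (X : measurableType d).
Implicit Types S T : aut X.

Lemma aut_eq S T : S =1 T -> S = T.
Proof.
move=> eST; have eV : aut_inv S = aut_inv T.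
  by apply/funext => x; rewrite -{1}(aut_invK T x) -eST aut_funK.
move/funext: eST eV; case: S => f f' a b c e; case: T => g g' a' b' c' e' /=.
move=> fg fg'; subst g g'.
by rewrite (Prop_irrelevance a a') (Prop_irrelevance b b')
  (Prop_irrelevance c c') (Prop_irrelevance e e').
Qed.

HB.instance Definition _ := gen_eqMixin (aut X).
HB.instance Definition _ := gen_choiceMixin (aut X).

Definition aut_one : aut X := @Aut d X idfun idfun (fun=> erefl) (fun=> erefl)
  (@measurable_id _ X setT) (@measurable_id _ X setT).

Definition aut_inverse T : aut X :=
  Aut (aut_invK T) (aut_funK T) (measurable_aut_inv T) (measurable_aut_fun T).

Definition aut_mul S T : aut X :=
  Aut (can_comp (aut_funK S) (aut_funK T)) (can_comp (aut_invK T) (aut_invK S))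
    (measurableT_comp (measurable_aut_fun S) (measurable_aut_fun T))
    (measurableT_comp (measurable_aut_inv T) (measurable_aut_inv S)).

Let aut_mulA : associative aut_mul.
Proof. by move=> S T U; exact: aut_eq. Qed.

Let aut_mul1 : left_id aut_one aut_mul.
Proof. by move=> S; exact: aut_eq. Qed.

Let aut_1mul : right_id aut_one aut_mul.
Proof. by move=> S; exact: aut_eq. Qed.

Let aut_mulV : left_inverse aut_one aut_inverse aut_mul.
Proof. by move=> S; apply: aut_eq => x /=; rewrite aut_funK. Qed.

Let aut_Vmul : right_inverse aut_one aut_inverse aut_mul.
Proof. by move=> S; apply: aut_eq => x /=; rewrite aut_invK. Qed.

HB.instance Definition _ := isGroup.Build (aut X)
  aut_mulA aut_mul1 aut_1mul aut_mulV aut_Vmul.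

Definition Ctbl : set (aut X) := [set T | countable [set x | T x <> x]].

Lemma Ctbl1 : Ctbl 1%g.
Proof.
rewrite /Ctbl /= (_ : [set x | _] = set0) ?countable0//.
by apply/seteqP; split => x /=.
Qed.

Lemma CtblM S T : Ctbl S -> Ctbl T -> Ctbl (S * T)%g.
Proof.
move=> cS cT; have cST : countable ([set x | S x <> x] `|` [set x | T x <> x]).
  by rewrite -bigcup2E; apply: bigcup_countable => // -[|[|n]] _ /=.
apply: (sub_countable _ cST); apply: subset_card_le => x /= STx.
have [Tx|] := pselect (T x = x); last by right.
by left => Sx; apply: STx; change (S (T x) = x); rewrite Tx.
Qed.

Lemma CtblV T : Ctbl T -> Ctbl (T^-1)%g.
Proof.
apply: sub_countable; apply: subset_card_le => x /= Tx e; apply: Tx.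
by rewrite -{1}e; exact: aut_funK.
Qed.

Lemma CtblJ S T : Ctbl T -> Ctbl (T ^ S)%g.
Proof.
move=> cT; have := sub_countable (card_image_le (aut_inv S) _) cT.
apply: sub_countable; apply: subset_card_le => x /= TSx.
exists (S x) => [e|]; last exact: aut_funK.
apply: TSx; rewrite -[RHS](aut_funK S) -[in RHS]e; exact: erefl.
Qed.

Definition Ctbl_rel S T : bool := `[< Ctbl (S^-1 * T)%g >].

Lemma Ctbl_rel_refl : reflexive Ctbl_rel.
Proof. by move=> S; apply/asboolP; rewrite mulVg; exact: Ctbl1. Qed.

Lemma Ctbl_rel_sym : symmetric Ctbl_rel.
Proof.
move=> S T; apply: asbool_equiv_eq; split => /CtblV; by rewrite invgM invgK.
Qed.

Lemma Ctbl_rel_trans : transitive Ctbl_rel.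
Proof.
move=> T S U /asboolP ST /asboolP TU; apply/asboolP.
by have := CtblM ST TU; rewrite -mulgA mulVKg.
Qed.

Canonical Ctbl_equiv :=
  EquivRel Ctbl_rel Ctbl_rel_refl Ctbl_rel_sym Ctbl_rel_trans.

End aut_group.

Lemma metric_ball_open (R : realType) (M : metricType R) (x : M) (r : R) :
  open (ball x r).
Proof.
rewrite openE => y; rewrite ballEmdist /= => xy; apply/nbhs_ballP.
exists (r - mdist x y) => /=; first by rewrite subr_gt0.
move=> z; rewrite !ballEmdist/= ltrBrDl; apply: le_lt_trans.
exact: metric_triangle.
Qed.

Section uniform_topology.
Context (R : realType) d (X : standardBorelType R d).
Implicit Types S T U : aut X.

(* The set written E(S, T) in the literature on the uniform topology. *)
Definition aut_neq S T : set X :=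
  [set x | T x <> S x] `|` [set x | aut_inv S x <> aut_inv T x].

Definition aut_ball T n (mu : 'I_n -> probability X R) (eps : R) :
    set (aut X) :=
  [set S | forall i, (mu i (aut_neq S T) < eps%:E)%E].

Definition aut_nbhs T : set_system (aut X) :=
  [set A | exists n (mu : 'I_n -> probability X R) (eps : R),
    0 < eps /\ aut_ball T mu eps `<=` A].

Lemma measurable_neq (f g : X -> X) : measurable_fun setT f ->
  measurable_fun setT g -> measurable [set x | f x <> g x].
Proof.
move=> mf mg.
have [M [h [_ [D cD dD] bh hE]]] := @standard_borel R d X.
pose B (q : M) (k : nat) : set X := h @^-1` ball q k.+1%:R^-1.
have mB q k : measurable (B q k).
  rewrite hE; exists (ball q k.+1%:R^-1); last by rewrite setTI.
  by apply: sub_sigma_algebra; exact: metric_ball_open.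
rewrite (_ : [set x | _] = \bigcup_k \bigcup_(q in D)
   (f @^-1` B q k `\` g @^-1` B q k)).
  apply: bigcupT_measurable => k.
  pose C q : set X := f @^-1` B q k `\` g @^-1` B q k.
  have mC q : measurable (C q).
    by apply: measurableD; rewrite -[X in measurable X]setTI; [apply: mf|apply: mg].
  have /countable_injP[e einj] := cD.
  rewrite (_ : \bigcup_(q in D) _ =
      \bigcup_n \bigcup_(q in [set q | D q /\ e q = n]) C q).
    apply: bigcupT_measurable => n.
    have [[q [Dq eq]]|nq] := pselect (exists q, D q /\ e q = n).
      rewrite (_ : [set _ | _] = [set q]) ?bigcup_set1//.
      apply/seteqP; split => [r /= [Dr er]|r ->//].
      by apply: einj; rewrite ?inE// er eq.
    rewrite (_ : [set _ | _] = set0) ?bigcup_set0//.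
    by apply/seteqP; split => [r /= [Dr er]|r//]; apply: nq; exists r.
  apply/seteqP; split => [x [q Dq Cx]|x [n _ [q [Dq _] Cx]]]; last by exists q.
  by exists (e q) => //; exists q.
apply/seteqP; split => [x /= fgx|x [k _ [q _ [fB gB]]] /= fgx]; last first.
  by apply: gB; rewrite /= -fgx.
have hfg : h (f x) != h (g x).
  by apply/eqP => /(bij_inj bh).
have d0 : 0 < mdist (h (f x)) (h (g x)) / 2 by rewrite divr_gt0// mdist_gt0.
have [k] := @ltr_add_invr R 0 _ d0; rewrite add0r => kd.
have k0 : 0 < k.+1%:R^-1 :> R by rewrite invr_gt0.
have [|q [xq Dq]] := dD (ball (h (f x)) k.+1%:R^-1) _ (metric_ball_open _ _).
  by exists (h (f x)); exact: ballxx.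
exists k => //; exists q => //; split; first exact: ball_sym.
move=> /= /(ball_triangle xq); rewrite ballEmdist/= ltNge => /negP; apply.
by rewrite [leRHS]splitr lerD// ltW.
Qed.

Lemma measurable_aut_neq S T : measurable (aut_neq S T).
Proof.
by apply: measurableU; apply: measurable_neq;
  (exact: measurable_aut_fun || exact: measurable_aut_inv).
Qed.

Lemma aut_neqxx T : aut_neq T T = set0.
Proof. by apply/seteqP; split => x // [] /=. Qed.

Lemma aut_neq_trans S T U : aut_neq U T `<=` aut_neq U S `|` aut_neq S T.
Proof.
move=> x [/= TU|/= UT].
  have [ST|] := pselect (T x = S x); last by move=> ?; right; left.
  by left; left => /=; rewrite -ST.
have [ST|] := pselect (aut_inv S x = aut_inv T x); last by move=> ?; right; right.
by left; right => /=; rewrite ST.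
Qed.

Lemma aut_ball_center T n (mu : 'I_n -> probability X R) (eps : R) :
  0 < eps -> aut_ball T mu eps T.
Proof. by move=> e0 i; rewrite aut_neqxx measure0 lte_fin. Qed.

Lemma aut_ball_ball T S n (mu : 'I_n -> probability X R) (eps : R) :
  aut_ball T mu eps S ->
  exists2 eps' : R, 0 < eps' & aut_ball S mu eps' `<=` aut_ball T mu eps.
Proof.
move=> TS; pose m i := fine (mu i (aut_neq S T)).
have mE i : mu i (aut_neq S T) = (m i)%:E.
  by rewrite fineK// fin_num_measure//; exact: measurable_aut_neq.
have me i : m i < eps by rewrite -lte_fin -mE.
exists (\big[Num.min/1]_(i < n) (eps - m i)).
  by apply/bigmin_gtP; split => [|i _]; rewrite ?ltr01// subr_gt0.
move=> U SU i; apply: (@le_lt_trans _ _ (mu i (aut_neq U S `|` aut_neq S T))).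
  apply: le_measure; rewrite ?inE; [exact: measurable_aut_neq| |exact: aut_neq_trans].
  by apply: measurableU; exact: measurable_aut_neq.
apply: (@le_lt_trans _ _ (mu i (aut_neq U S) + mu i (aut_neq S T))%E).
  by apply: measureU2; exact: measurable_aut_neq.
rewrite mE -lteBrDr// -EFinB; apply: (lt_le_trans (SU i)).
by rewrite lee_fin; exact: bigmin_le.
Qed.

Let aut_nbhs_filter T : ProperFilter (aut_nbhs T).
Proof.
split.
  move=> [n [mu [e [e0 sub]]]].
  by have := sub T (aut_ball_center _ _ e0).
split.
- by exists 0%N, (fun=> \d_point : probability X R), 1.
- move=> A B [n [mu [e [e0 sA]]]] [m [nu [r [r0 sB]]]].
  exists (n + m)%N, (fun i => match fintype.split i with inl j => mu j | inr j => nu j end).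
  exists (Num.min e r); split; first by rewrite lt_min e0.
  move=> S TS; split; [apply: sA|apply: sB] => i.
    have := TS (lshift m i); rewrite (unsplitK (inl i)) => /lt_le_trans; apply.
    by rewrite lee_fin ge_min lexx.
  have := TS (rshift n i); rewrite (unsplitK (inr i)) => /lt_le_trans; apply.
  by rewrite lee_fin ge_min lexx orbT.
- move=> A B AB [n [mu [e [e0 sA]]]].
  by exists n, mu, e; split => //; exact: subset_trans AB.
Qed.

Let aut_nbhs_singleton T (A : set (aut X)) : aut_nbhs T A -> A T.
Proof. by move=> [n [mu [e [e0]]]]; apply; exact: aut_ball_center. Qed.

Let aut_nbhs_nbhs T (A : set (aut X)) :
  aut_nbhs T A -> aut_nbhs T (aut_nbhs^~ A).
Proof.
move=> [n [mu [e [e0 sA]]]]; exists n, mu, e; split => // S /aut_ball_ball.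
move=> [e' e'0 sub]; exists n, mu, e'; split => //.
exact: subset_trans sA.
Qed.

HB.instance Definition _ := hasNbhs.Build (aut X) aut_nbhs.
HB.instance Definition _ := Nbhs_isNbhsTopological.Build (aut X)
  aut_nbhs_filter aut_nbhs_singleton aut_nbhs_nbhs.

Lemma aut_ball_open T n (mu : 'I_n -> probability X R) (eps : R) :
  open (aut_ball T mu eps).
Proof.
rewrite openE => S /aut_ball_ball[e e0 sub].
by exists n, mu, e.
Qed.

Lemma aut_nbhs_ball T (mu : probability X R) (eps : R) : 0 < eps ->
  nbhs T [set S | (mu (aut_neq S T) < eps%:E)%E].
Proof.
by move=> e0; exists 1%N, (fun=> mu), eps; split => // S; apply; exact: ord0.
Qed.

HB.instance Definition _ T :=
  isMeasurableFun.Build _ _ _ _ (aut_fun T) (measurable_aut_fun T).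

Let pre T (mu : probability X R) : probability X R := distribution mu (aut_fun T).

Lemma aut_neqM S T S' T' : aut_neq (S' * T')%g (S * T)%g `<=`
  (aut_neq T' T `|` T @^-1` aut_neq S' S) `|`
  (aut_neq S' S `|` aut_inv S @^-1` aut_neq T' T).
Proof.
move=> x [/= ST|/= ST].
  left; have [TT|] := pselect (T x = T' x); last by left; left.
  by right; left => /=; rewrite [in X in _ <> X]TT.
right; have [SS|] := pselect (aut_inv S' x = aut_inv S x); last by left; right.
by right; right => /=; rewrite -[in X in X <> _]SS.
Qed.

Let aut_mulg_continuous : continuous (fun xy : aut X * aut X => (xy.1 * xy.2)%g).
Proof.
move=> [S T] A /= [n [mu [e [e0 sA]]]].
have e40 : 0 < e / 2 / 2 by rewrite !divr_gt0.
pose near4 (U V : aut X) (nu : 'I_n -> probability X R) :=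
  forall i, (mu i (aut_neq V U) < (e / 2 / 2)%:E)%E /\
            (nu i (aut_neq V U) < (e / 2 / 2)%:E)%E.
have nbhs4 (U : aut X) nu : nbhs U (fun V => near4 U V nu).
  refine (@filter_forall _ _ _ (nbhs U) (nbhs_filter U) _) => i.
  by apply: filterI; exact: aut_nbhs_ball.
exists ((fun S' => near4 S S' (fun i => pre T (mu i))),
        (fun T' => near4 T T' (fun i => pre S^-1%g (mu i)))).
  by split; exact: nbhs4.
move=> [S' T'] /= [nS nT]; apply: sA => i.
have [S1 S2] := nS i; have [T1 T2] := nT i.
have mS := measurable_aut_neq S' S; have mT := measurable_aut_neq T' T.
have mTS : measurable (T @^-1` aut_neq S' S).
  by rewrite -[X in measurable X]setTI; exact: (measurable_aut_fun T).
have mST : measurable (aut_inv S @^-1` aut_neq T' T).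
  by rewrite -[X in measurable X]setTI; exact: (measurable_aut_inv S).
apply: (@le_lt_trans _ _ (mu i ((aut_neq T' T `|` T @^-1` aut_neq S' S) `|`
    (aut_neq S' S `|` aut_inv S @^-1` aut_neq T' T)))).
  apply: le_measure; rewrite ?inE; [exact: measurable_aut_neq| |exact: aut_neqM].
  by do 2 apply: measurableU => //; exact: measurableU.
apply: (le_lt_trans (measureU2 _ (measurableU _ _ mT mTS)
  (measurableU _ _ mS mST))).
rewrite (_ : e = (e / 2 / 2 + e / 2 / 2) + (e / 2 / 2 + e / 2 / 2));
  last by rewrite -!splitr.
rewrite !EFinD; apply: lteD.
  by apply: (le_lt_trans (measureU2 _ _ _)) => //; exact: lteD.
by apply: (le_lt_trans (measureU2 _ _ _)) => //; exact: lteD.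
Qed.

Let aut_invg_continuous : continuous (fun x : aut X => (x^-1)%g).
Proof.
move=> T A /= [n [mu [e [e0 sA]]]]; exists n, mu, e; split => // S nS.
apply: sA => i; rewrite (_ : aut_neq _ _ = aut_neq S T)//.
by apply/seteqP; split => x [/=|/=] h; [right|left|right|left] => /= /esym.
Qed.

HB.instance Definition _ := isTopologicalGroup.Build (aut X)
  aut_mulg_continuous aut_invg_continuous.

End uniform_topology.

(* Ctbl is normal in aut X, so its left cosets form a group. *)
Definition aut0 (R : realType) d (X : standardBorelType R d) : Type :=
  quotient_topology {eq_quot Ctbl_equiv X}%qT.

Section aut0.
Context (R : realType) d (X : standardBorelType R d).
Local Open Scope quotient_scope.
Implicit Types S T : aut X.

HB.instance Definition _ := Choice.on (aut0 X).
HB.instance Definition _ := Quotient.on (aut0 X).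
HB.instance Definition _ := Topological.on (aut0 X).

Definition pi0 S : aut0 X := \pi_(aut0 X) S.

Lemma pi0P S T : pi0 S = pi0 T <-> Ctbl (S^-1 * T)%g.
Proof.
change (S = T %[mod {eq_quot Ctbl_equiv X}] <-> Ctbl (S^-1 * T)%g).
by split => [/eqmodP/asboolP|?]; [|apply/eqmodP/asboolP].
Qed.

Lemma pi0_repr (x : aut0 X) : pi0 (repr x) = x.
Proof. exact: reprK. Qed.

Lemma pi0M S T S' T' :
  pi0 S = pi0 S' -> pi0 T = pi0 T' -> pi0 (S * T)%g = pi0 (S' * T')%g.
Proof.
move=> /pi0P SS /pi0P TT; apply/pi0P.
rewrite mulVg_conj.
by apply: CtblM => //; exact: CtblJ.
Qed.

Lemma pi0V S T : pi0 S = pi0 T -> pi0 S^-1%g = pi0 T^-1%g.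
Proof.
move=> /pi0P/CtblV ST; apply/pi0P; rewrite invgK.
by rewrite mulgV_conj; exact: CtblJ.
Qed.

Definition aut0_mul (x y : aut0 X) : aut0 X := pi0 (repr x * repr y)%g.
Definition aut0_inv (x : aut0 X) : aut0 X := pi0 (repr x)^-1%g.

Let pi0_mul S T : aut0_mul (pi0 S) (pi0 T) = pi0 (S * T)%g.
Proof. by apply: pi0M; rewrite pi0_repr. Qed.

Let pi0_inv S : aut0_inv (pi0 S) = pi0 S^-1%g.
Proof. by apply: pi0V; rewrite pi0_repr. Qed.

Let aut0_mulA : associative aut0_mul.
Proof.
move=> x y z; rewrite -(pi0_repr x) -(pi0_repr y) -(pi0_repr z).
by rewrite !pi0_mul mulgA.
Qed.

Let aut0_mul1 : left_id (pi0 1%g) aut0_mul.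
Proof. by move=> x; rewrite -(pi0_repr x) pi0_mul mul1g. Qed.

Let aut0_1mul : right_id (pi0 1%g) aut0_mul.
Proof. by move=> x; rewrite -(pi0_repr x) pi0_mul mulg1. Qed.

Let aut0_mulV : left_inverse (pi0 1%g) aut0_inv aut0_mul.
Proof. by move=> x; rewrite -(pi0_repr x) pi0_inv pi0_mul mulVg. Qed.

Let aut0_Vmul : right_inverse (pi0 1%g) aut0_inv aut0_mul.
Proof. by move=> x; rewrite -(pi0_repr x) pi0_inv pi0_mul mulgV. Qed.

HB.instance Definition _ := isGroup.Build (aut0 X)
  aut0_mulA aut0_mul1 aut0_1mul aut0_mulV aut0_Vmul.

Lemma pi0_mulg S T : pi0 (S * T)%g = (pi0 S * pi0 T)%g.
Proof. by rewrite -pi0_mul. Qed.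

Lemma pi0_invg S : pi0 S^-1%g = ((pi0 S)^-1)%g.
Proof. by rewrite -pi0_inv. Qed.

Lemma pi0_continuous : continuous pi0.
Proof. exact: pi_continuous. Qed.

Lemma pi0_open (U : set (aut X)) : open U -> open (pi0 @` U).
Proof.
move=> oU; change (open (pi0 @^-1` (pi0 @` U))).
rewrite (_ : _ @^-1` _ =
    \bigcup_(C in @Ctbl d X) ((fun S => (S * C)%g) @^-1` U)).
  apply: bigcup_open => C _; apply: open_comp => // S _.
  move=> A nA; have [[V W] [/= nV nW] VW] := @mulg_continuous (aut X) (S, C) A nA.
  apply: filterS nV => S' VS'.
  by apply: (VW (S', C)); split => //; exact: nbhs_singleton nW.
apply/seteqP; split => S /=.
  move=> [T UT /esym/pi0P ST]; exists (S^-1 * T)%g => //=.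
  by rewrite mulVKg.
by move=> [C cC USC]; exists (S * C)%g => //; apply/esym/pi0P; rewrite mulKg.
Qed.

Let aut0_mulg_continuous :
  continuous (fun xy : aut0 X * aut0 X => (xy.1 * xy.2)%g).
Proof.
move=> [x y] A /= nA; rewrite -(pi0_repr x) -(pi0_repr y) in nA *.
rewrite -pi0_mulg in nA.
have [[U V] [/= nU nV] UV] := @mulg_continuous (aut X) (repr x, repr y) _
  (pi0_continuous nA).
exists (pi0 @` U°, pi0 @` V°) => /=.
  by split; apply: open_nbhs_nbhs; split;
    [apply: pi0_open; exact: open_interior|exists (repr x)|
     apply: pi0_open; exact: open_interior|exists (repr y)].
move=> [_ _] /= [[S US <-] [T VT <-]]; rewrite -pi0_mulg.
by apply: (UV (S, T)); split; exact: interior_subset.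
Qed.

Let aut0_invg_continuous : continuous (fun x : aut0 X => (x^-1)%g).
Proof.
apply/quotient_continuous.
rewrite (_ : _ \o _ = pi0 \o (fun S => S^-1)%g); last first.
  by apply/funext => S /=; rewrite pi0_invg.
by move=> S; apply: continuous_comp; [exact: invg_continuous|exact: pi0_continuous].
Qed.

HB.instance Definition _ := isTopologicalGroup.Build (aut0 X)
  aut0_mulg_continuous aut0_invg_continuous.

End aut0.

(* Main.v *)
Require Import Defs.
From mathcomp Require Import all_boot all_order all_algebra.
From mathcomp Require Import all_classical all_reals all_analysis.
From mathcomp Require Import measurable_realfun ring lra.

(** The quotient kills countable sets, hence the atoms of measures, and this is
    what makes paths possible.  An involution I is joined to the identity by
    switching it on gradually: X embeds into the line, and I_t is I on the pairs
    {x, I x} that have a point below t, the identity elsewhere.  For a diffuse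
    measure the set where I_s and I_t differ becomes negligible as s tends to t
    ([linked_involution]).  The classes joined to the identity form a normal
    subgroup, so it remains to write every class as a product of involutions
    and of commutators of such products with other elements.

    Suppose that some probability mu on X gives positive mass to the set of its
    non-atoms.  Given an automorphism T, that set is covered by the fixed points
    of T and by countably many sets that T moves off themselves, so there is a
    set A, not negligible and free of atoms, with T = 1 on A or A disjoint from
    T(A).  In the second case the involution that exchanges A and T(A) brings T
    back to the first one.  When T fixes A, there is room in A for infinitely
    many copies of X ([disjoint_copies]); an involution moves the support of T
    into one of them, and there T is the commutator of the shift of the copies
    with the automorphism that acts as T on half of the copies
    ([fiber_commutator]).  The shift is a product of two involutions, as
    translations of the integers are products of two reflections.

    The copies of X come from the measure: X is a Borel retract of the line
    ([real_coding]), the image of A contains a closed set F of positive measure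
    ([inner_closed]), and the quantile function of the measure on F is an
    injection of an interval into F, with the distribution function as left
    inverse ([quantile]).

    Suppose on the contrary that every probability is carried by a countable set.
    Then any two automorphisms have representatives that agree on the sets
    carrying finitely many given measures, so the quotient topology is
    indiscrete ([pi0_indiscrete]) and every map into it is a path. *)

Set Implicit Arguments.
Unset Strict Implicit.
Unset Printing Implicit Defensive.
Import Order.TTheory GRing.Theory Num.Theory.
Import numFieldNormedType.Exports.

Local Open Scope classical_set_scope.
Local Open Scope ring_scope.

(** * Countable sets and null sequences of sets *)

Lemma countable_preimage (T U : Type) (f : T -> U) (A : set T) (B : set U) :
  injective f -> countable B -> (forall x, A x -> B (f x)) -> countable A.
Proof.
move=> f_inj /countable_injP[g g_inj] AB; apply/countable_injP; exists (g \o f).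
move=> x y /[!inE] Ax Ay /= gxy; apply: f_inj; apply: g_inj => //; rewrite inE;
  exact: AB.
Qed.

Lemma countable_setU (T : Type) (A B : set T) :
  countable A -> countable B -> countable (A `|` B).
Proof.
by move=> cA cB; rewrite -bigcup2E; apply: bigcup_countable => // -[|[|k]] _ /=.
Qed.

Lemma measure_vanishing_seq (R : realType) d (T : measurableType d)
    (mu : {measure set T -> \bar R}) (E : (set T)^nat) :
  (mu setT < +oo)%E -> (forall k, measurable (E k)) ->
  nonincreasing_seq E -> \bigcap_k E k = set0 ->
  forall e : R, 0 < e -> exists k, (mu (E k) < e%:E)%E.
Proof.
move=> mu_fin mE niE E0 e e0.
have : mu (E k) @[k --> \oo] --> (0 : \bar R)%E.
  rewrite -(measure0 mu) -E0; apply: nonincreasing_cvg_mu => //.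
    by apply: le_lt_trans mu_fin; apply: le_measure; rewrite ?inE.
  by rewrite E0.
have /[swap]/[apply] : nbhs (0 : \bar R)%E [set y | (y < e%:E)%E].
  by apply: open_nbhs_nbhs; split; [exact: open_ereal_lt_ereal|rewrite /= lte_fin].
by move=> [k _ /(_ _ (leqnn k)) ?]; exists k.
Qed.

Lemma measurable_eq (R : realType) d (X : standardBorelType R d) (f g : X -> X) :
  measurable_fun setT f ->
  measurable_fun setT g -> measurable [set x | f x = g x].
Proof.
move=> mf mg; rewrite (_ : [set x | _] = ~` [set x | f x <> g x]).
  by apply: measurableC; exact: measurable_neq.
by apply/seteqP; split => x /=; [move=> -> | exact: contrapT].
Qed.

(** * Automorphisms defined piecewise *)

Section piecewise.
Context d (X : measurableType d).
Implicit Types (D : set X) (f g : X -> X).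

Lemma measurable_if D f g : measurable D -> measurable_fun setT f ->
  measurable_fun setT g ->
  measurable_fun setT (fun x => if x \in D then f x else g x).
Proof.
move=> mD mf mg; apply: measurable_fun_ifT => //.
apply: (measurable_fun_bool true) => /=; rewrite setTI.
rewrite (_ : _ @^-1` _ = D)//.
by apply/seteqP; split => x /= => [/set_mem|/mem_set].
Qed.

(** Serves to move the support of an automorphism into another set, and to
    replace an automorphism, on a set that it pushes off itself, by an
    involution. *)
Lemma swap_aut (B C : set X) (u v : X -> X) : measurable B -> measurable C ->
    B `&` C = set0 -> measurable_fun setT u -> measurable_fun setT v ->
    (forall x, B x -> C (u x) /\ v (u x) = x) ->
    (forall x, C x -> B (v x) /\ u (v x) = x) ->
  exists I : aut X, [/\ involutive I, forall x, B x -> I x = u x,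
    forall x, C x -> I x = v x & forall x, ~ B x -> ~ C x -> I x = x].
Proof.
move=> mB mC BC mu mv uP vP.
pose f x := if x \in B then u x else if x \in C then v x else x.
have mf : measurable_fun setT f by do 2 apply: measurable_if => //.
have fB x : B x -> f x = u x by move=> Bx; rewrite /f mem_set.
have fC x : C x -> f x = v x.
  move=> Cx; rewrite /f memNset ?mem_set// => Bx.
  by have : (B `&` C) x by []; rewrite BC.
have fN x : ~ B x -> ~ C x -> f x = x by move=> Bx Cx; rewrite /f !memNset.
have fK : involutive f.
  move=> x; have [Bx|Bx] := pselect (B x).
    by have [Cu vu] := uP _ Bx; rewrite (fB x)// fC.
  have [Cx|Cx] := pselect (C x); last by rewrite !fN.
  by have [Bv uv] := vP _ Cx; rewrite (fC x)// fB.
have If : Aut fK fK mf mf =1 f by [].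
exists (Aut fK fK mf mf); split => [x|x|x|x]; rewrite !If.
- exact: fK.
- exact: fB.
- exact: fC.
- exact: fN.
Qed.

Section aut_cut.
Variables (U : aut X) (D : set X).
Hypotheses (mD : measurable D) (UD : forall x, D (U x) <-> D x).

Let cut_fun f x := if x \in D then f x else x.

Let VD x : D (aut_inv U x) <-> D x.
Proof. by rewrite -(UD (aut_inv U x)) aut_invK. Qed.

Let cut_funK : cancel (cut_fun U) (cut_fun (aut_inv U)).
Proof.
move=> x; rewrite /cut_fun; have [Dx|Dx] := pselect (D x).
  by rewrite (mem_set Dx) mem_set ?aut_funK//; exact/UD.
by rewrite (memNset Dx) memNset.
Qed.

Let cut_invK : cancel (cut_fun (aut_inv U)) (cut_fun U).
Proof.
move=> x; rewrite /cut_fun; have [Dx|Dx] := pselect (D x).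
  by rewrite (mem_set Dx) mem_set ?aut_invK//; exact/VD.
by rewrite (memNset Dx) memNset.
Qed.

Definition aut_cut : aut X := Aut cut_funK cut_invK
  (measurable_if mD (measurable_aut_fun U) (@measurable_id _ X setT))
  (measurable_if mD (measurable_aut_inv U) (@measurable_id _ X setT)).

Lemma aut_cut_in x : D x -> aut_cut x = U x.
Proof. by move=> Dx /=; rewrite /cut_fun mem_set. Qed.

Lemma aut_cut_out x : ~ D x -> aut_cut x = x.
Proof. by move=> Dx /=; rewrite /cut_fun memNset. Qed.

Lemma aut_cut_inv_in x : D x -> aut_inv aut_cut x = aut_inv U x.
Proof. by move=> Dx /=; rewrite /cut_fun mem_set. Qed.

Lemma aut_cut_inv_out x : ~ D x -> aut_inv aut_cut x = x.
Proof. by move=> Dx /=; rewrite /cut_fun memNset. Qed.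

End aut_cut.

End piecewise.

Arguments aut_cut {d X} U {D} mD UD : simpl never.

Lemma aut_mulE d (X : measurableType d) (S T : aut X) x : (S * T)%g x = S (T x).
Proof. by []. Qed.

Lemma aut_invE d (X : measurableType d) (T : aut X) x : (T^-1)%g x = aut_inv T x.
Proof. by []. Qed.

(** * Elements joined to the identity by a path *)

Section linked.
Context (R : realType) (G : topologicalGroupType).
Implicit Types g h : G.

(** The path is continuous on the whole line, not only on the unit interval, so
    that paths can be multiplied pointwise without restricting topologies. *)
Definition linked g :=
  exists f : R -> G, [/\ continuous f, f 0 = 1%g & f 1 = g].

Lemma continuous_mul (f g : R -> G) : continuous f -> continuous g ->
  continuous (fun t => f t * g t)%g.
Proof.
move=> cf cg t.
apply: (@continuous_comp _ _ _ (fun t => (f t, g t))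
  (fun xy : G * G => (xy.1 * xy.2)%g)); last exact: mulg_continuous.
by apply: cvg_pair; [exact: cf|exact: cg].
Qed.

Lemma linkedM g h : linked g -> linked h -> linked (g * h)%g.
Proof.
move=> [f [cf f0 f1]] [k [ck k0 k1]]; exists (fun t => f t * k t)%g.
by split; [exact: continuous_mul|rewrite f0 k0 mulg1|rewrite f1 k1].
Qed.

Lemma linkedV g : linked g -> linked g^-1%g.
Proof.
move=> [f [cf f0 f1]]; exists (fun t => (f t)^-1)%g.
split; [|by rewrite f0 invg1|by rewrite f1].
move=> t; apply: (@continuous_comp _ _ _ f (fun x : G => x^-1)%g).
  exact: cf.
exact: invg_continuous.
Qed.

Lemma linkedJ g h : linked g -> linked (h * g * h^-1)%g.
Proof.
move=> [f [cf f0 f1]]; exists (fun t => h * f t * h^-1)%g.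
split; [|by rewrite f0 mulg1 mulgV|by rewrite f1].
by do 2 (apply: continuous_mul => //; try by move=> t; exact: cvg_cst).
Qed.

Lemma linked_path_connected : (forall g, linked g) -> path_connected R G.
Proof.
move=> lG x y; have [f [cf f0 f1]] := lG (x^-1 * y)%g.
exists (fun t => x * f t)%g; split; [|by rewrite f0 mulg1|by rewrite f1 mulVKg].
apply: continuous_subspaceT; apply: continuous_mul => // t; exact: cvg_cst.
Qed.

End linked.

(** * Involutions *)

Section quotient.
Context (R : realType) d (X : standardBorelType R d).
Implicit Types (S T : aut X).

Lemma pi0_eq S T (N : set X) : countable N ->
  (forall x, ~ N x -> S x = T x) -> pi0 S = pi0 T.
Proof.
move=> cN ST; apply/pi0P; apply: sub_countable cN; apply: subset_card_le.
move=> x /= STx; apply: contrapT => /ST Sx; apply: STx.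
by rewrite -Sx aut_funK.
Qed.

Lemma nbhs_pi0 T (A : set (aut0 X)) : nbhs (pi0 T) A ->
  exists n (mu : 'I_n -> probability X R) (eps : R),
    0 < eps /\ forall S, aut_ball T mu eps S -> A (pi0 S).
Proof. by move=> /pi0_continuous. Qed.

(** The involution is switched on gradually: at time t it acts on the invariant
    set of the pairs {x, I x} on which the smaller value of phi is below t.  The
    sets increase with t, and the pairs that enter at one given time are
    countably many, so for every measure the path is continuous up to a set
    that disappears in the quotient. *)
Lemma linked_involution (phi : X -> R) (I : aut X) :
    measurable_fun setT phi -> injective phi -> (forall x, 0 < phi x < 1) ->
    involutive I -> linked R (pi0 I : (aut0 X : topologicalGroupType)).
Proof.
move=> mphi phi_inj phi01 IK.
pose m x := Num.min (phi x) (phi (I x)).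
have mm : measurable_fun setT m.
  apply: measurable_minr => //.
  exact: (measurableT_comp mphi (measurable_aut_fun I)).
have mI x : m (I x) = m x by rewrite /m IK minC.
have mfib s : countable [set x | m x = s].
  have := countable_setU
    (countable_preimage (A := phi @^-1` [set s]) phi_inj (countable1 s) (fun x => id))
    (countable_preimage (A := (phi \o I) @^-1` [set s])
      (inj_comp phi_inj (inv_inj IK)) (countable1 s) (fun x => id)).
  apply: sub_countable; apply: subset_card_le => x /=.
  by rewrite /m /Num.min; case: ifP => _ ->; [left|right].
have mset (B : set R) : measurable B -> measurable (m @^-1` B).
  by move=> mB; rewrite -[X in measurable X]setTI; exact: mm.
(* D' s t is D t without the points that enter at time s, which are countably
   many: the representative that it gives of the class at time t is close to the
   one at time s also when t > s. *)
pose D t := m @^-1` `]-oo, t[; pose D' s t := m @^-1` (`]-oo, t[ `\ s).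
have mD t : measurable (D t) by apply: mset.
have mD' s t : measurable (D' s t) by apply: mset; exact: measurableD.
have ID t x : D t (I x) <-> D t x by rewrite /D /= mI.
have ID' s t x : D' s t (I x) <-> D' s t x by rewrite /D' /= mI.
exists (fun t => pi0 (aut_cut I (mD t) (ID t))); split; last first.
- congr pi0; apply: aut_eq => x; apply: aut_cut_in; rewrite /D /= in_itv /=.
  by rewrite gt_min; have /andP[_ ->] := phi01 x.
- apply: (@pi0_eq _ 1%g set0) => // x _; apply: aut_cut_out.
  rewrite /D /= in_itv /=; apply/negP; rewrite -leNgt le_min.
  by have /andP[/ltW -> _] := phi01 x; have /andP[/ltW -> _] := phi01 (I x).
move=> s A /= /nbhs_pi0[n [mu [eps [e0 ballA]]]].
(* Contains the points on which the representatives at times s and t differ, when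
   r = |t - s|; these sets decrease to the empty set because m = s is excluded. *)
pose E (r : R) := m @^-1` (`[s - r, s + r] `\ s).
have mE r : measurable (E r) by apply: mset; exact: measurableD.
have muE i : \forall t \near s, (mu i (E `|t - s|%R) < eps%:E)%E.
  have E0 : \bigcap_k E k.+1%:R^-1 = set0.
    apply/seteqP; split => // x /= Ex.
    have [_ /eqP ms] := Ex 0%N Logic.I.
    have /(@ltr_add_invr R 0)[k] : 0 < `|m x - s|.
      by rewrite normr_gt0 subr_eq0.
    rewrite add0r ltNge; have [mk _] := Ex k Logic.I.
    by rewrite /= in_itv /= -ler_distl in mk; rewrite mk.
  have [||||| k muk] :=
    @measure_vanishing_seq R _ _ (mu i) (fun k => E k.+1%:R^-1) _ _ _ _ eps.
  - by rewrite (le_lt_trans (probability_le1 _ _))// ltry.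
  - by [].
  - move=> j k jk; apply/subsetPset => x [/=].
    rewrite !in_itv /= -!ler_distl => /le_trans mk ?; split => //.
    by rewrite /= in_itv /= -ler_distl mk// lef_pV2 ?posrE// ler_nat.
  - by [].
  - by [].
  have : \forall t \near s, `|t - s| <= k.+1%:R^-1.
    apply/nbhs_ballP; exists k.+1%:R^-1 => //= t.
    by rewrite -ball_normE /= distrC => /ltW.
  apply: filterS => t tk; apply: le_lt_trans muk.
  apply: le_measure; rewrite ?inE// => x [/=].
  rewrite !in_itv /= -!ler_distl => mt ?; split => //.
  by rewrite /= in_itv /= -ler_distl (le_trans mt).
have : \forall t \near s, forall i, (mu i (E `|t - s|%R) < eps%:E)%E.
  by refine (@filter_forall _ _ _ (nbhs s) (nbhs_filter s) _).
apply: filterS => t muEt /=.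
rewrite (_ : pi0 _ = pi0 (aut_cut I (mD' s t) (ID' s t))); last first.
  apply: (@pi0_eq _ _ [set x | m x = s]) => // x xs.
  have [Dx|Dx] := pselect (D t x); first by rewrite !aut_cut_in.
  by rewrite !aut_cut_out// => -[].
apply: ballA => i; apply: le_lt_trans (muEt i).
apply: le_measure; rewrite ?inE//; first exact: measurable_aut_neq.
move=> x; apply: contraPP => Ex.
have DD' : D s x <-> D' s t x.
  split => [|[]]; rewrite /D /D' /= !in_itv /=.
    move=> ms; split; last by move=> e; rewrite e ltxx in ms.
    rewrite ltNge; apply/negP => tm; apply: Ex; split.
      rewrite /= in_itv /= -ler_distl distrC (distrC t) !ger0_norm ?subr_ge0.
      - by rewrite lerB.
      - exact: le_trans (ltW ms).
      - exact: ltW.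
    by move=> /= e; rewrite e ltxx in ms.
  move=> mt ms; rewrite lt_neqAle; apply/andP; split; first exact/eqP.
  rewrite leNgt; apply/negP => sm; apply: Ex; split => //.
  rewrite /= in_itv /= -ler_distl !ger0_norm ?subr_ge0.
  - by rewrite lerB// ltW.
  - exact: ltW (lt_trans sm mt).
  - exact: ltW.
have [Dx|Dx] := pselect (D s x).
  have D'x := iffLR DD' Dx.
  by rewrite /aut_neq /setU /mkset !aut_cut_in ?aut_cut_inv_in// => -[].
have D'x : ~ D' s t x by move/DD'.
by rewrite /aut_neq /setU /mkset !aut_cut_out ?aut_cut_inv_out// => -[].
Qed.

End quotient.

(** * Coding points by real numbers *)

Section digits.
Context (R : realType).
Implicit Types b : nat -> bool.

Fixpoint base4 b j : nat := if j is i.+1 then (4 * base4 b i + b i)%N else 0%N.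

Definition partial4 b j : R := (base4 b j)%:R / 4 ^+ j.

(** Only the digits 0 and 1 are used, so that a tail of the expansion is at most
    a third of the unit of the last digit before it: in contrast with base 2, the
    digits can be read off from the sum. *)
Definition code4 b : R := sups (partial4 b) 0.

(** The base is even, so that the parity of the integer part is that of its last
    digit. *)
Definition digit4 j (y : R) : bool := odd (Num.truncn (4 ^+ j.+1 * y)).

Lemma partial4S b j : partial4 b j.+1 = partial4 b j + (b j)%:R / 4 ^+ j.+1.
Proof.
rewrite /partial4 /= natrD natrM exprS.
have : 4 ^+ j != 0 :> R by rewrite expf_neq0.
by move=> ?; field.
Qed.

Lemma partial4_nd b : nondecreasing_seq (partial4 b).
Proof.
apply/nondecreasing_seqP => j; rewrite partial4S lerDl.
by rewrite divr_ge0// exprn_ge0.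
Qed.

Lemma partial4_le b i j : partial4 b i <= partial4 b j + 3^-1 / 4 ^+ j.
Proof.
pose v k := partial4 b k + 3^-1 / 4 ^+ k.
have vni : nonincreasing_seq v.
  apply/nonincreasing_seqP => k; rewrite /v partial4S -addrA lerD2l exprS.
  have p : 0 < (4 ^+ k)^-1 :> R by rewrite invr_gt0 exprn_gt0.
  rewrite invfM; set w := (4 ^+ k)^-1 in p *.
  by case: (b k) => /=; lra.
have [ij|/ltnW ji] := leqP i j.
  apply: le_trans (partial4_nd b ij) _.
  by rewrite lerDl divr_ge0// exprn_ge0.
by apply: le_trans (vni _ _ ji); rewrite /v lerDl divr_ge0// exprn_ge0.
Qed.

Lemma partial4_has_ubound b : has_ubound (range (partial4 b)).
Proof. by exists (partial4 b 0 + 3^-1 / 4 ^+ 0) => _ [i _ <-]; exact: partial4_le. Qed.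

Lemma code4E b : code4 b = sup (range (partial4 b)).
Proof.
by rewrite /code4 /sups; congr sup; apply/seteqP; split => _ [n _ <-] /=; exists n.
Qed.

Lemma code4_ge b j : partial4 b j <= code4 b.
Proof. by rewrite code4E; apply: ub_le_sup; [exact: partial4_has_ubound|exists j]. Qed.

Lemma code4_le b j : code4 b <= partial4 b j + 3^-1 / 4 ^+ j.
Proof.
rewrite code4E; apply: ge_sup; first by exists (partial4 b 0), 0%N.
by move=> _ [i _ <-]; exact: partial4_le.
Qed.

Lemma code4_ge0 b : 0 <= code4 b.
Proof. by have := code4_ge b 0; rewrite /partial4 /= mul0r. Qed.

Lemma code4_le3V b : code4 b <= 3^-1.
Proof. by have := code4_le b 0; rewrite /partial4 /= mul0r add0r expr0 divr1. Qed.

Lemma code4K b j : digit4 j (code4 b) = b j.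
Proof.
rewrite /digit4 (_ : Num.truncn _ = base4 b j.+1); last first.
  apply: truncn_def.
  have p : 0 < 4 ^+ j.+1 :> R by rewrite exprn_gt0.
  have := code4_ge b j.+1; have := code4_le b j.+1.
  rewrite /partial4; set w := 4 ^+ j.+1 in p *; set c := code4 b.
  rewrite -mulrDl ler_pdivlMr// ler_pdivrMr// (mulrC c) => ? ?.
  by apply/andP; split => //; rewrite -natr1; lra.
by rewrite /= oddD oddM /=; case: (b j).
Qed.

Lemma measurable_truncn : measurable_fun setT (@Num.truncn R : R -> nat).
Proof.
apply: (measurability _ NGenCInfty.measurableE) => _ [_ [[|n] ->] <-].
  by rewrite setTI preimage_itvcy (_ : [set _ | _] = setT)//; apply/seteqP; split.
rewrite setTI preimage_itvcy (_ : [set _ | _] = `[n.+1%:R, +oo[%classic).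
  exact: measurable_itv.
by apply/seteqP; split => x /=; rewrite in_itv /= andbT -truncn_gt_nat.
Qed.

Lemma measurable_digit4 j : measurable_fun setT (digit4 j).
Proof.
apply: (@measurableT_comp _ _ _ _ _ _ (odd : nat -> bool)) => //.
apply: (@measurableT_comp _ _ _ _ _ _ (@Num.truncn R : R -> nat)).
  exact: measurable_truncn.
exact: measurable_funM.
Qed.

Lemma measurable_code4 d (X : measurableType d) (b : X -> nat -> bool) :
  (forall j, measurable_fun setT (b^~ j)) ->
  measurable_fun setT (fun x => code4 (b x)).
Proof.
move=> mb; apply: measurable_fun_sups => [x _|j].
  exact: partial4_has_ubound.
suff : measurable_fun setT (fun x => partial4 (b x) j) by [].
elim: j => [|j ih]; first by rewrite /partial4 /=; exact: measurable_cst.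
under eq_fun do rewrite partial4S.
apply: measurable_funD => //; apply: measurable_funM => //.
rewrite (_ : (fun _ => _) = (fun x => if b x j then 1 else 0)).
  exact: measurable_fun_ifT.
by apply/funext => x; case: (b x j).
Qed.

End digits.

Section decoding.
Context (R : realType) (M : metricType R) (q : nat -> M).
Hypothesis cM : complete_space M.
Variable P : nat -> nat -> Prop.

Let r k : R := k.+1%:R^-1.

Hypothesis Pex : forall k, exists n, P k n.
Hypothesis Pdist : forall k n k' n', P k n -> P k' n' ->
  mdist (q n) (q n') <= r k + r k'.

(** P k n stands for: the point to be found is at distance less than r k from
    q n.  This data is Cauchy, so by completeness it does come from a point. *)
Lemma decode_limit : exists z : M, forall k n, P k n -> mdist z (q n) <= r k.
Proof.
have [nu nuP] := choice Pex.
have r_lt e : 0 < e -> \forall k \near \oo, r k < e.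
  by move=> e0; exact: near_infty_natSinv_lt (PosNum e0).
have [|z zlim] := @cM (q \o nu @ \oo) _ _.
  apply: cauchy_exP => e e0.
  have : \forall i \near \oo, r i < e / 2 by apply: r_lt; rewrite divr_gt0.
  move=> [N _ Ne]; exists (q (nu N)); exists N => // i /= Ni.
  rewrite ballEmdist /=; apply: le_lt_trans (Pdist (nuP _) (nuP _)) _.
  by rewrite [e]splitr ltrD//; apply: Ne => /=.
exists z => k n Pkn; apply/ler_addgt0Pr => e e0.
have : \forall i \near \oo, mdist z (q (nu i)) < e / 2 /\ r i < e / 2.
  apply: filterI; last by apply: r_lt; rewrite divr_gt0.
  have : nbhs z (ball z (e / 2)) by apply: nbhsx_ballx; rewrite divr_gt0.
  by move=> /zlim; rewrite ballEmdist.
move=> [N _ /(_ _ (leqnn N)) /= [zN rN]].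
apply: le_trans (metric_triangle _ (q (nu N)) _) _.
apply: le_trans (lerD (ltW zN) (Pdist (nuP N) Pkn)) _.
by rewrite addrA addrC lerD2l [leRHS]splitr lerD// ltW.
Qed.

End decoding.

Section coding.
Context (R : realType) d (X : standardBorelType R d).

(** The code of x lists the pairs (k, n) such that the nth point of a dense
    sequence lies at distance less than 1 / (k + 1) from x.  Decoding takes a
    limit, which exists on the Borel set of the coherent codes; this is where
    completeness is used, and it makes the image of phi a Borel set. *)
Lemma real_coding : exists (phi : X -> R) (psi : R -> X),
  [/\ measurable_fun setT phi, measurable_fun setT psi, cancel phi psi
    & forall x, 0 < phi x < 1].
Proof.
have [M [f [cM [D cD dD] bf hE]]] := @standard_borel R d X.
have [q dq] : exists q : nat -> M, dense (range q).
  have : exists y, D y.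
    have [|y [_ Dy]] := dD setT _ openT; first by exists (f point).
    by exists y.
  move=> [y0 Dy0]; have /countable_injP[e einj] := cD.
  exists (fun n => xget y0 [set y | D y /\ e y = n]) => U U0 oU.
  have [y [Uy Dy]] := dD U U0 oU; exists y; split => //; exists (e y) => //.
  case: xgetP => [z _ [Dz ezy]|/(_ y) []]; last by split.
  by apply: einj; rewrite ?inE.
pose r k : R := k.+1%:R^-1.
have r0 k : 0 < r k by rewrite invr_gt0.
pose b x j := if unpickle j is Some kn then
  `[< mdist (f x) (q kn.2) < r kn.1 >] else false.
have mopen (U : set M) : open U -> measurable (f @^-1` U).
  move=> oU; rewrite hE; exists U; last by rewrite setTI.
  exact: sub_sigma_algebra.
have mb j : measurable_fun setT (b^~ j).
  rewrite /b; case: (unpickle j) => [[k n]|]; last exact: measurable_cst.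
  apply: (measurable_fun_bool true) => /=; rewrite setTI.
  rewrite (_ : _ @^-1` _ = f @^-1` ball (q n) (r k)).
    by apply: mopen; exact: metric_ball_open.
  by apply/seteqP; split => x; rewrite /= ballEmdist /= metric_sym => /asboolP.
(* The shift by 1/2 keeps the values inside the open unit interval. *)
pose phi x : R := 2^-1 + code4 R (b x).
have mphi : measurable_fun setT phi.
  by apply: measurable_funD => //; exact: measurable_code4.
have phi01 x : 0 < phi x < 1.
  have := code4_ge0 R (b x); have := code4_le3V R (b x); rewrite /phi.
  by move=> ? ?; apply/andP; split; lra.
pose P (y : R) (k n : nat) : Prop := digit4 (pickle (k, n)) (y - 2^-1).
have Pphi x k n : P (phi x) k n <-> mdist (f x) (q n) < r k.
  by rewrite /P /phi addrAC subrr add0r code4K /b pickleK /=; split => /asboolP.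
have mP k n : measurable [set y | P y k n].
  have : measurable_fun setT (fun y : R => digit4 (pickle (k, n)) (y - 2^-1)).
    apply: (@measurableT_comp _ _ _ _ _ _ (@digit4 R (pickle (k, n)))).
      exact: measurable_digit4.
    exact: measurable_funB.
  by move=> /(_ measurableT [set true]); rewrite setTI; apply.
(* Both conditions are those of decode_limit. *)
pose Gd : set R := (\bigcap_k \bigcup_n [set y | P y k n]) `&`
  (\bigcap_k \bigcap_n \bigcap_k' \bigcap_n'
    [set y | P y k n -> P y k' n' -> mdist (q n) (q n') <= r k + r k']).
have mGd : measurable Gd.
  apply: measurableI.
    by apply: bigcapT_measurable => k; exact: bigcupT_measurable.
  apply: bigcapT_measurable => i; apply: bigcapT_measurable => i0.
  apply: bigcapT_measurable => i1; apply: bigcapT_measurable => i2.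
  set c := (mdist _ _ <= _).
  have [Q|Q] := pselect c.
    rewrite (_ : [set y | _] = setT)//.
    apply/seteqP; split => y //= _ _ _.
  rewrite (_ : [set y | _] = ~` ([set y | P y i i0] `&` [set y | P y i1 i2])).
    by apply: measurableC; exact: measurableI.
  apply/seteqP; split => y /= h; first by move=> [/h] /[apply].
  by move=> h1 h2; case: h.
pose lim y x := forall k n, P y k n -> mdist (f x) (q n) <= r k.
have Gdlim y : Gd y -> exists x, lim y x.
  move=> [G1 G2].
  have [||z zP] := @decode_limit _ _ q cM (P y).
  - by move=> k; have [n _ Pn] := G1 k I; exists n.
  - by move=> k n k' n'; exact: (G2 k I n I k' I n' I).
  have [g fg gf] := bf; exists (g z) => k n; rewrite gf; exact: zP.
have [psi psiG psiN] : exists2 psi : R -> X, forall y, Gd y -> lim y (psi y) &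
    forall y, ~ Gd y -> psi y = point.
  exists (fun y => if pselect (Gd y) is left Gy then projT1 (cid (Gdlim _ Gy))
    else point) => y Gy; case: pselect => // Gy'; by case: cid.
exists phi, psi; split => //.
  move=> _ A; rewrite hE => -[B sB <-]; rewrite !setTI.
  suff : <<s @open M >> `<=` [set B | measurable (psi @^-1` (f @^-1` B))].
    by move/(_ _ sB).
  apply: smallest_sub => [|U oU /=].
    split => /= [|E|E]; first by rewrite !preimage_set0.
      by rewrite setTD => mE; exact: measurableC mE.
    by move=> mE; rewrite !preimage_bigcup; exact: bigcupT_measurable.
  (* The decoded point lies in U as soon as one of the balls known to contain
     it is included in U, and such a ball exists because U is open. *)
  pose V := \bigcup_k \bigcup_(n in [set n | [set w | mdist w (q n) <= r k] `<=` U])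
    [set y | P y k n].
  rewrite (_ : _ @^-1` _ = (Gd `&` V) `|` (~` Gd `&` [set y | U (f point)])).
    apply: measurableU; apply: measurableI => //.
    - apply: bigcupT_measurable => k; rewrite bigcup_mkcond.
      by apply: bigcupT_measurable => n; case: ifP.
    - exact: measurableC.
    - have [Q|Q] := pselect (U (f point)).
        by rewrite (_ : [set y | _] = setT)//; apply/seteqP; split.
      by rewrite (_ : [set y | _] = set0)//; apply/seteqP; split.
  apply/seteqP; split => y /=.
    have [Gy|Gy] := pselect (Gd y); last by rewrite psiN//; right.
    move=> Uy; left; split => //.
    have /nbhs_ballP[e /= e0 eU] := open_nbhs_nbhs (conj oU Uy).
    have e20 : 0 < e / 2 by rewrite divr_gt0.
    have [k] := @ltr_add_invr R 0 _ e20; rewrite add0r => ke.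
    have [n _ Pn] := Gy.1 k I.
    exists k => //; exists n => // w wq; apply: eU; rewrite ballEmdist /=.
    apply: le_lt_trans (metric_triangle _ (q n) _) _.
    rewrite [e]splitr ltrD//.
      exact: le_lt_trans (psiG _ Gy _ _ Pn) ke.
    by rewrite metric_sym; exact: le_lt_trans wq ke.
  move=> [[Gy [k _ [n nU Pn]]]|[Gy Uy]]; last by rewrite psiN.
  by apply: nU; exact: psiG.
move=> x.
have Gx : Gd (phi x).
  split => [k _|k _ n _ k' _ n' _ /= /Pphi xn /Pphi xn'].
    have [|z [xq [n _ qn]]] := dq (ball (f x) (r k)) _ (metric_ball_open _ _).
      by exists (f x); exact: ballxx.
    by exists n => //; apply/Pphi; rewrite -qn ballEmdist in xq.
  apply: le_trans (metric_triangle _ (f x) _) _.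
  by rewrite lerD// ltW// metric_sym.
apply: (bij_inj bf); apply: mdist_positivity.
apply/eqP; rewrite eq_le mdist_ge0 andbT; apply/ler_addgt0Pr => e e0.
rewrite add0r.
have e20 : 0 < e / 2 by rewrite divr_gt0.
have [k] := @ltr_add_invr R 0 _ e20; rewrite add0r => ke.
have [n _ Pn] := Gx.1 k I.
apply: le_trans (metric_triangle _ (q n) _) _.
rewrite [e]splitr lerD//.
  exact: le_trans (psiG _ Gx _ _ Pn) (ltW ke).
by rewrite metric_sym; apply: ltW; apply: lt_trans ke; apply/Pphi.
Qed.

End coding.

(** * Finite measures on the real line *)

Section regularity.
Context (R : realType) (nu : {measure set R -> \bar R}).
Hypothesis nu_fin : (nu setT < +oo)%E.

Let nu_lty (A : set R) : measurable A -> (nu A < +oo)%E.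
Proof. by move=> mA; apply: le_lt_trans nu_fin; apply: le_measure; rewrite ?inE. Qed.

(** The outer approximation by open sets is what makes the inner approximation
    by closed sets stable under complement. *)
Definition approximable (A : set R) := forall e : R, 0 < e ->
  exists F U : set R, [/\ closed F, open U, F `<=` A, A `<=` U
    & (nu (U `\` F) < e%:E)%E].

Lemma approximable_ray x : approximable `]x, +oo[.
Proof.
move=> e e0.
pose E k : set R := `]x, x + k.+1%:R^-1[%classic.
have [|||k Ek] := @measure_vanishing_seq R _ _ nu E nu_fin _ _ _ e e0.
- by move=> k; exact: measurable_itv.
- move=> j k jk; apply/subsetPset => y; rewrite /E /= !in_itv /= => /andP[-> yk].
  by rewrite (lt_le_trans yk)// lerD2l lef_pV2 ?posrE// ler_nat.
- apply/seteqP; split => // y Ey.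
  have /(@ltr_add_invr R)[k] : x < y.
    by have := Ey 0%N I; rewrite /E /= in_itv /= => /andP[].
  have := Ey k I; rewrite /E /= in_itv /= => /andP[_ yk].
  by rewrite ltNge (ltW yk).
exists `[x + k.+1%:R^-1, +oo[%classic, `]x, +oo[%classic; split => //.
- exact: rray_closed.
- by apply: subset_itvr; rewrite bnd_simp ltrDl invr_gt0.
- rewrite (_ : _ `\` _ = E k)// /E; apply/seteqP; split => y /=; rewrite !in_itv /= !andbT.
    by move=> [-> /negP]; rewrite -ltNge.
  by move=> /andP[-> yk]; split=> //; apply/negP; rewrite -ltNge.
Qed.

Lemma approximableC A : approximable A -> approximable (~` A).
Proof.
move=> aA e e0; have [F [U [cF oU FA AU UF]]] := aA e e0.
exists (~` U), (~` F); split; [exact: open_closedC|exact: closed_openC| | |].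
- exact: subsetC.
- exact: subsetC.
- by rewrite setDE setCK setIC -setDE.
Qed.

(** A countable union of closed sets need not be closed: finitely many of them
    are kept, enough for the others to be small. *)
Lemma approximable_bigcup (A : (set R)^nat) :
  (forall i, approximable (A i)) -> approximable (\bigcup_i A i).
Proof.
move=> aA e e0.
have e2i i : 0 < e / 2 / 2 ^+ i.+1 by rewrite !divr_gt0// exprn_gt0.
have /choice[F /choice[U FUi]] i := aA i _ (e2i i).
have cF i : closed (F i) by have [] := FUi i.
have oU i : open (U i) by have [] := FUi i.
have mF i : measurable (F i) by exact: closed_measurable.
have mU i : measurable (U i) by exact: open_measurable.
pose G k := \bigcup_(i < k) F i.
have mG k : measurable (G k) by apply: bigcup_measurable.
have mGT : measurable (\bigcup_i F i) by exact: bigcupT_measurable.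
have [||||k Gk] := @measure_vanishing_seq R _ _ nu
  (fun k => \bigcup_i F i `\` G k) nu_fin _ _ _ (e / 2).
- by move=> k; exact: measurableD.
- move=> j k jk; apply/subsetPset; apply: setDS.
  by apply: bigcup_sub => i /= ij; apply: bigcup_sup => /=; exact: leq_trans ij jk.
- apply/seteqP; split => // x xG; have [[i _ Fi] _] := xG 0%N I.
  by have [_] := xG i.+1 I; apply; exists i => /=.
- by rewrite divr_gt0.
exists (G k), (\bigcup_i U i); split.
- rewrite /G bigcup_mkord; apply: closed_bigsetU => i _; exact: cF.
- by apply: bigcup_open => i _; exact: oU.
- by move=> x [i _ Fx]; exists i => //; have [_ _ FA _ _] := FUi i; exact: FA.
- by move=> x [i _ Ax]; exists i => //; have [_ _ _ AU _] := FUi i; exact: AU.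
have sub : \bigcup_i U i `\` G k `<=`
    \bigcup_i (U i `\` F i) `|` (\bigcup_i F i `\` G k).
  move=> x [[i _ Ui] Gx]; have [Fx|Fx] := pselect ((\bigcup_i F i) x); first by right.
  by left; exists i => //; split => // Fi; apply: Fx; exists i.
have mUF : measurable (\bigcup_i (U i `\` F i)).
  by apply: bigcupT_measurable => i; exact: measurableD.
apply: (@le_lt_trans _ _ (nu (\bigcup_i (U i `\` F i) `|` (\bigcup_i F i `\` G k)))).
  apply: le_measure; rewrite ?inE//; last by apply: measurableU => //; exact: measurableD.
  by apply: measurableD => //; exact: bigcupT_measurable.
apply: le_lt_trans (measureU2 _ mUF _) _; first exact: measurableD.
rewrite [e]splitr EFinD; apply: lee_ltD => //.
  by rewrite ge0_fin_numE// nu_lty.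
have mUFi i : measurable (U i `\` F i) by exact: measurableD.
apply: le_trans (measure_sigma_subadditive nu mUFi mUF (@subset_refl _ _)) _.
apply: le_trans (epsilon_trick0 xpredT _); last by rewrite divr_ge0// ltW.
apply: lee_nneseries => // i _; rewrite natrX.
by have [_ _ _ _ /ltW] := FUi i.
Qed.

Lemma measurable_approximable A : measurable A -> approximable A.
Proof.
rewrite [X in X A -> _](RGenOInfty.measurableE R); apply: smallest_sub => /=.
  split => [|B|B]; [| |exact: approximable_bigcup].
    move=> e e0; exists set0, set0; rewrite setD0 measure0 lte_fin.
    by split => //; exact: closed0.
  by rewrite setTD; exact: approximableC.
by move=> _ [x ->]; exact: approximable_ray.
Qed.

Lemma inner_closed A : measurable A -> (0 < nu A)%E ->
  exists F, [/\ closed F, F `<=` A & (0 < nu F)%E].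
Proof.
move=> mA A0.
have fA : nu A \is a fin_num by rewrite ge0_fin_numE// nu_lty.
have fA0 : 0 < fine (nu A) by rewrite -lte_fin fineK.
have [F [U [cF oU FA AU UF]]] := measurable_approximable mA fA0.
have mF := closed_measurable cF; have mU := open_measurable oU.
exists F; split => //; rewrite lt0e measure_ge0 andbT; apply/eqP => F0.
move: UF; rewrite fineK// ltNge => /negP; apply.
have mUF : measurable (U `\` F) by exact: measurableD.
rewrite -[leRHS]adde0 -F0; apply: le_trans (measureU2 _ mUF mF).
apply: le_measure; rewrite ?inE//; first exact: measurableU.
by move=> x /AU Ux; have [Fx|Fx] := pselect (F x); [right|left].
Qed.

End regularity.

Section quantile.
Context (R : realType) (nu : {measure set R -> \bar R}).
Hypothesis nu_fin : (nu setT < +oo)%E.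

(** G is the distribution function of nu on F and H its quantile function.  As
    nu has no atom, G is continuous and H is a section of G; as F is closed, it
    contains the infimum that defines H.  The last clause is what makes H
    measurable. *)
Lemma quantile (F : set R) : closed F -> (0 < nu F)%E ->
    (forall x, F x -> nu [set x] = 0%E) ->
  exists (G H : R -> R) (M : R), [/\ 0 < M, nondecreasing_fun G
    & forall y, 0 < y < M ->
      [/\ F (H y), G (H y) = y & forall a, (H y <= a) = (y <= G a)]].
Proof.
move=> cF F0 noatom.
have mF := closed_measurable cF.
have nu_le (A B : set R) : measurable A -> measurable B -> A `<=` B ->
  (nu A <= nu B)%E by move=> mA mB AB; apply: le_measure; rewrite ?inE.
have fin (A : set R) : measurable A -> nu A \is a fin_num.
  move=> mA; rewrite ge0_fin_numE//; apply: le_lt_trans nu_fin.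
  exact: nu_le.
have mFi (i : interval R) : measurable (F `&` [set` i]).
  by apply: measurableI => //; exact: measurable_itv.
pose G x := fine (nu (F `&` `]-oo, x])).
have GE x : nu (F `&` `]-oo, x]) = (G x)%:E by rewrite fineK// fin.
have FE : nu F = (fine (nu F))%:E by rewrite fineK// fin.
have Gnd : nondecreasing_fun G.
  move=> x y xy; rewrite -lee_fin -!GE; apply: nu_le => //.
  by apply: setIS; apply: subset_itvl; rewrite bnd_simp.
have Gadd a b (e : R) : a <= b -> (nu (F `&` `]a, b]) < e%:E)%E -> G b < G a + e.
  move=> ab abe; rewrite -lte_fin EFinD -!GE.
  apply: (@le_lt_trans _ _ (nu (F `&` `]-oo, a]) + nu (F `&` `]a, b]))%E).
    apply: le_trans (measureU2 _ (mFi _) (mFi _)).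
    apply: nu_le => //; first exact: measurableU.
    move=> x [Fx] /=; rewrite !in_itv /= => xb.
    have [xa|xa] := leP x a; [left|right]; split => //.
  by rewrite lteD2lE// fin.
exists G, (fun y => inf [set x | y <= G x]), (fine (nu F)).
split => // [|y /andP[y0 yM]]; first by rewrite -lte_fin -FE.
set S := [set x | y <= G x]; set h := inf S.
have S0 : S !=set0.
  have [||||k Ek] := @measure_vanishing_seq R _ _ nu
    (fun k => F `&` `]k%:R, +oo[) nu_fin _ _ _ (fine (nu F) - y).
  - by [].
  - move=> j k jk; apply/subsetPset; apply: setIS; apply: subset_itvr.
    by rewrite bnd_simp ler_nat.
  - apply/seteqP; split => // x xE; have [_ ] := xE (Num.bound `|x|) I.
    rewrite /= in_itv /= andbT ltNge => /negP; apply.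
    exact: ltW (le_lt_trans (ler_norm _) (archi_boundP (normr_ge0 _))).
  - by rewrite subr_gt0.
  exists k%:R; rewrite /S /=; apply: ltW.
  rewrite -(ltrD2r (fine (nu F) - y)) addrC subrK -lte_fin -FE EFinD -GE.
  apply: (@le_lt_trans _ _ (nu (F `&` `]-oo, k%:R]) + nu (F `&` `]k%:R, +oo[))%E).
    apply: le_trans (measureU2 _ (mFi _) (mFi _)).
    apply: nu_le => //; first exact: measurableU.
    move=> x Fx; have [xa|xa] := leP x k%:R; [left|right]; split => //=.
    by rewrite in_itv /= xa.
  by rewrite lteD2lE// fin.
have Slb : has_lbound S.
  have [||||k Ek] := @measure_vanishing_seq R _ _ nu
    (fun k => F `&` `]-oo, - k%:R]) nu_fin _ _ _ y.
  - by [].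
  - move=> j k jk; apply/subsetPset; apply: setIS; apply: subset_itvl.
    by rewrite bnd_simp lerN2 ler_nat.
  - apply/seteqP; split => // x xE; have [_ ] := xE (Num.bound `|x|) I.
    rewrite /= in_itv /= leNgt => /negP; apply.
    rewrite ltrNl; apply: le_lt_trans (ler_norm _) _; rewrite normrN.
    exact: archi_boundP (normr_ge0 _).
  - by [].
  rewrite GE lte_fin in Ek.
  exists (- k%:R) => x Sx; rewrite leNgt; apply/negP => /ltW /Gnd xk.
  by have := le_lt_trans (le_trans Sx xk) Ek; rewrite ltxx.
have Sinf : has_inf S by [].
have hlb x : S x -> h <= x by move=> Sx; exact: ge_inf.
have hNS x : 0 < x -> ~ S (h - x).
  by move=> x0 /hlb; rewrite leNgt gtrDl oppr_lt0 x0.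
have r0 k : 0 < k.+1%:R^-1 :> R by rewrite invr_gt0.
have rle j k : (j <= k)%N -> k.+1%:R^-1 <= j.+1%:R^-1 :> R.
  by move=> jk; rewrite lef_pV2 ?posrE// ler_nat.
(* Right continuity of G. *)
have yGh : y <= G h.
  rewrite leNgt; apply/negP => Ghy.
  have [||||k Ek] := @measure_vanishing_seq R _ _ nu
    (fun k => F `&` `]h, h + k.+1%:R^-1]) nu_fin _ _ _ (y - G h).
  - by [].
  - move=> j k jk; apply/subsetPset; apply: setIS; apply: subset_itvl.
    by rewrite bnd_simp lerD2l rle.
  - apply/seteqP; split => // x xE.
    have /(@ltr_add_invr R)[k] : h < x.
      by have [_ /=] := xE 0%N I; rewrite in_itv /= => /andP[].
    by have [_ /=] := xE k I; rewrite in_itv /= leNgt => /andP[_ /negPf ->].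
  - by rewrite subr_gt0.
  have : G (h + k.+1%:R^-1) < G h + (y - G h) by apply: Gadd => //; rewrite lerDl ltW.
  rewrite (addrC (G h)) subrK ltNge => /negP; apply.
  have [s Ss sh] := @inf_adherent _ S _ (r0 k) Sinf.
  by apply: le_trans Ss (Gnd _ _ (ltW sh)).
(* Left continuity of G: h is not an atom of nu on F. *)
have Ghy : G h <= y.
  rewrite leNgt; apply/negP => yGh'.
  pose E k := (F `&` `]h - k.+1%:R^-1, h]) `\ h.
  have [||||k Ek] := @measure_vanishing_seq R _ _ nu E nu_fin _ _ _ (G h - y).
  - by move=> k; apply: measurableD.
  - move=> j k jk; apply/subsetPset; apply: setSD; apply: setIS; apply: subset_itvr.
    by rewrite bnd_simp lerD2l lerN2 rle.
  - apply/seteqP; split => // x xE.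
    have /(@ltr_add_invr R)[k] : x < h.
      have [[_ /=]] := xE 0%N I; rewrite in_itv /= => /andP[_ xh] /eqP ?.
      by rewrite lt_neqAle xh andbT.
    have [[_ /=]] := xE k I; rewrite in_itv /= ltrBlDr => /andP[hx _ ] _.
    by rewrite ltNge ltW.
  - by rewrite subr_gt0.
  have := @Gadd (h - k.+1%:R^-1) h (G h - y); rewrite gerBl ltW// => /(_ isT).
  have Nh : nu (F `&` [set h]) = 0%E.
    have [Fh|Fh] := pselect (F h).
      by rewrite setIidr ?noatom// => _ ->.
    rewrite (_ : _ `&` _ = set0) ?measure0//.
    by apply/seteqP; split => // x [Fx /= xh]; apply: Fh; rewrite -xh.
  have mFh : measurable (F `&` [set h]) by exact: measurableI.
  have mE : measurable (E k) by exact: measurableD.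
  pose a := h - k.+1%:R^-1; rewrite -/a.
  have : (nu (F `&` `]a, h]) < (G h - y)%:E)%E.
    apply: le_lt_trans Ek; rewrite -[leRHS]adde0 -Nh.
    apply: le_trans (measureU2 _ mE mFh).
    apply: nu_le => //; first exact: measurableU.
    move=> x Fx; have [xh|xh] := pselect (x = h); [right|left]; split => //.
    by case: Fx.
  move=> /[swap]/[apply]; rewrite addrCA ltrDl subr_gt0 => /ltW.
  exact: hNS.
split => [||a].
- apply: contrapT => Fh.
  have [e /= e0 eF] : \forall x \near h, ~ F x.
    by apply: open_nbhs_nbhs; split => //; exact: closed_openC.
  have e20 : 0 < e / 2 by rewrite divr_gt0.
  apply: (hNS _ e20); rewrite /S /=; apply: le_trans yGh _.
  rewrite -lee_fin -!GE; apply: nu_le => // x [Fx] /=; rewrite in_itv /= => xh.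
  split => //=; rewrite in_itv /= leNgt; apply/negP => hx.
  apply: (eF x) => //=; rewrite ger0_norm ?subr_ge0// ltrBlDr -ltrBlDl.
  by apply: lt_trans hx; rewrite ltrD2l ltrN2 ltr_pdivrMr// ltr_pMr// ltr1n.
- by apply/eqP; rewrite eq_le Ghy yGh.
- apply/idP/idP => [ha|]; first by apply: le_trans yGh (Gnd _ _ ha).
  exact: hlb.
Qed.

End quantile.

(** * Copies of the whole space inside a non-atomic set *)

Section disjoint_copies.
Context (R : realType) d (X : standardBorelType R d).
Variables (phi : X -> R) (psi : R -> X).
Hypotheses (mphi : measurable_fun setT phi) (mpsi : measurable_fun setT psi).
Hypotheses (phiK : cancel phi psi) (phi01 : forall x, 0 < phi x < 1).

(** A set that carries a diffuse measure contains infinitely many disjoint Borel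
    copies of X.  The measure is pushed to the line by phi; its restriction to
    a closed subset of phi(A) has a quantile function H, which embeds the
    interval of the masses into phi(A). *)
Lemma disjoint_copies (mu : probability X R) (A : set X) : measurable A ->
    (0 < mu A)%E -> (forall x, A x -> mu [set x] = 0%E) ->
  exists (e : nat * X -> X) (q : X -> nat * X),
    [/\ measurable_fun setT e, measurable_fun setT q, cancel e q
      & forall y, A (e y)].
Proof.
move=> mA A0 noatom.
(* The structure of measure on a pushforward takes as an argument the proof that
   the map is measurable. *)
pose nu_of : {measure set R -> \bar R} :=
  pushforward (mrestr mu mA) phi.
pose nu := nu_of mphi.
have nuE B : nu B = mu (phi @^-1` B `&` A) by [].
have nu_fin : (nu setT < +oo)%E.
  rewrite nuE preimage_setT setTI.
  by apply: le_lt_trans (probability_le1 mu mA) _; rewrite ltry.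
pose B : set R := psi @^-1` A `&` [set y | phi (psi y) = y].
have mB : measurable B.
  apply: measurableI; first by rewrite -[X in measurable X]setTI; exact: mpsi.
  have := measurable_fun_eqr (measurableT_comp mphi mpsi) (@measurable_id _ R setT).
  move=> /(_ measurableT [set true] I); rewrite setTI.
  by congr measurable; apply/seteqP; split => y /= /eqP.
have nuB : (0 < nu B)%E.
  rewrite nuE (_ : _ `&` _ = A)//; apply/seteqP; split => x; first by case.
  by move=> Ax; split => //; split; rewrite /= phiK.
have [F [cF FB F0]] := inner_closed nu_fin mB nuB.
have [|G [H [M [M0 Gnd GH]]]] := quantile nu_fin cF F0.
  move=> y /FB [/= Ay yE]; rewrite nuE.
  rewrite (_ : _ `&` _ = [set psi y]) ?noatom//.
  apply/seteqP; split => [x [/= <- _]|x ->]; first by rewrite phiK.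
  by split.
(* Encodes (n, x) as n + phi x, whose integer part is n, and brings the result
   into the interval on which H is defined by a decreasing exponential. *)
pose s (p : nat * X) : R := M * expR (- (p.1%:R + phi p.2)).
have s01 p : 0 < s p < M.
  rewrite /s pmulr_rgt0 ?expR_gt0//= gtr_pMr// -expR0 ltr_expR.
  by rewrite oppr_lt0 ltr_wpDl//; have /andP[] := phi01 p.2.
have ms : measurable_fun setT s.
  apply: measurable_funM => //; apply: measurableT_comp => //.
  apply: measurable_funN; apply: measurable_funD; last first.
    exact: measurableT_comp mphi measurable_snd.
  by apply: (@measurableT_comp _ _ _ _ _ _ (fun n : nat => n%:R : R)).
have mHs : measurable_fun setT (H \o s).
  apply: (measurability _ (RGenOInfty.measurableE R)) => _ [_ [a ->] <-].
  rewrite setTI (_ : _ @^-1` _ = s @^-1` `]G a, +oo[).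
    by rewrite -[X in measurable X]setTI; apply: ms => //; exact: measurable_itv.
  apply/seteqP; split => p /=; rewrite !in_itv /= !andbT !ltNge;
    by have [_ _ ->] := GH _ (s01 p).
exists (psi \o (H \o s)).
pose u x : R := - ln (M^-1 * G (phi x)).
exists (fun x => (Num.truncn (u x), psi (u x - (Num.truncn (u x))%:R))).
have HB p : B (H (s p)) by have [/FB] := GH _ (s01 p).
split.
- exact: measurableT_comp mpsi mHs.
- have mu' : measurable_fun setT u.
    apply: measurableT_comp => //; apply: measurableT_comp => //.
    apply: measurable_funM => //; apply: measurableT_comp mphi.
    exact: nondecreasing_measurable.
  have mtu : measurable_fun setT (fun x => Num.truncn (u x)).
    exact: (measurableT_comp (@measurable_truncn R) mu').
  apply: measurable_fun_pair => //.
  apply: measurableT_comp mpsi _; apply: measurable_funB => //.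
  exact: (@measurableT_comp _ _ _ _ _ _ (fun n : nat => n%:R : R)).
- move=> [n x] /=.
  have [_ /= HE] := HB (n, x).
  have [_ GE _] := GH _ (s01 (n, x)).
  have uE : u (psi (H (s (n, x)))) = n%:R + phi x.
    rewrite /u HE GE /s mulrA mulVf ?gt_eqF// mul1r expRK opprK//.
  rewrite uE (_ : Num.truncn _ = n).
    by rewrite addrAC subrr add0r phiK.
  apply: truncn_def; have /andP[p0 p1] := phi01 x.
  by rewrite lerDl ltW// -natr1 ltrD2l.
- by move=> p; have [] := HB p.
Qed.

End disjoint_copies.

(** * A commutator on infinitely many copies *)

Section copies.
Context (R : realType) d (X : standardBorelType R d).
Variables (e : nat * X -> X) (q : X -> nat * X).
Hypotheses (me : measurable_fun setT e) (mq : measurable_fun setT q).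
Hypothesis eK : cancel e q.
Implicit Types Th : aut (nat * X)%type.

Let ext_fun (f : nat * X -> nat * X) x :=
  if `[< e (q x) = x >] then e (f (q x)) else x.

Let measurable_ext f : measurable_fun setT f -> measurable_fun setT (ext_fun f).
Proof.
move=> mf; apply: measurable_fun_ifT => //.
  apply: (measurable_fun_bool true); rewrite setTI.
  rewrite (_ : _ @^-1` _ = [set x | e (q x) = x]).
    by apply: measurable_eq => //; exact: measurableT_comp me mq.
  by apply/seteqP; split => x /= /asboolP.
by apply: measurableT_comp me _; exact: measurableT_comp mf mq.
Qed.

Let ext_funK f g : cancel f g -> cancel (ext_fun f) (ext_fun g).
Proof.
move=> fK x; rewrite /ext_fun; have [ex|ex] := pselect (e (q x) = x).
  by rewrite (asboolT ex) eK asboolT// fK.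
by rewrite !(asboolF ex).
Qed.

(** The embedding e carries an automorphism of the disjoint union of copies to
    one of X, trivial outside the image of e. *)
Definition ext Th : aut X := Aut (ext_funK (aut_funK Th)) (ext_funK (aut_invK Th))
  (measurable_ext (measurable_aut_fun Th)) (measurable_ext (measurable_aut_inv Th)).

Lemma extE Th y : ext Th (e y) = e (Th y).
Proof. by rewrite /= /ext_fun eK asboolT. Qed.

Lemma ext_out Th x : e (q x) <> x -> ext Th x = x.
Proof. by move=> ex; rewrite /= /ext_fun asboolF. Qed.

Lemma ext_mul Th Th' : ext (Th * Th')%g = (ext Th * ext Th')%g.
Proof.
apply: aut_eq => x; rewrite aut_mulE.
have [ex|ex] := pselect (e (q x) = x); last by rewrite !ext_out.
by rewrite -ex !extE.
Qed.

Lemma ext_inv Th : ext (Th^-1)%g = ((ext Th)^-1)%g.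
Proof. exact: aut_eq. Qed.

Lemma ext_involutive Th : involutive Th -> involutive (ext Th).
Proof.
move=> ThK x; have [ex|ex] := pselect (e (q x) = x); last by rewrite !ext_out.
by rewrite -ex !extE ThK.
Qed.

End copies.

Section fiberwise.
Context d (X : measurableType d).
Implicit Types (T : aut X) (Q : pred nat).

Lemma measurable_pred_fst Q : measurable_fun setT (fun p : nat * X => Q p.1).
Proof. exact: (measurableT_comp (f := Q)). Qed.

Let fiber_fun Q (f : X -> X) (p : nat * X) := (p.1, if Q p.1 then f p.2 else p.2).

Let fiber_funK Q f g : cancel f g -> cancel (fiber_fun Q f) (fiber_fun Q g).
Proof. by move=> fK [n x]; rewrite /fiber_fun /=; case: (Q n); rewrite ?fK. Qed.

Let measurable_fiber Q f : measurable_fun setT f ->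
  measurable_fun setT (fiber_fun Q f).
Proof.
move=> mf; apply: measurable_fun_pair => //; apply: measurable_fun_ifT => //.
  exact: measurable_pred_fst.
exact: measurableT_comp mf measurable_snd.
Qed.

(** T acts on the copies with an index in Q, the other copies are fixed. *)
Definition fiber Q T : aut (nat * X)%type :=
  Aut (fiber_funK Q (aut_funK T)) (fiber_funK Q (aut_invK T))
    (measurable_fiber Q (measurable_aut_fun T))
    (measurable_fiber Q (measurable_aut_inv T)).

Let index_fun (i : nat -> nat) (p : nat * X) := (i p.1, p.2).

Let measurable_index i : measurable_fun setT (index_fun i).
Proof.
apply: measurable_fun_pair => //.
exact: (measurableT_comp (f := i)).
Qed.

Let index_funK i : involutive i -> involutive (index_fun i).
Proof. by move=> iK [n x]; rewrite /index_fun /= iK. Qed.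

Definition reindex i (iK : involutive i) : aut (nat * X)%type :=
  Aut (index_funK iK) (index_funK iK) (measurable_index i) (measurable_index i).

Lemma reindex_involutive i (iK : involutive i) : involutive (reindex iK).
Proof. exact: index_funK. Qed.

(** flip0 exchanges 2k with 2k+1, and flip1 exchanges 2k+1 with 2k+2.  Their
    product is a bijection of nat with the single orbit
    ... 4, 2, 0, 1, 3, 5 ...; so it is the shift of a copy of the integers,
    and a product of two involutions. *)
Definition flip0 n := if odd n then n.-1 else n.+1.

Definition flip1 n := if n is m.+1 then (flip0 m).+1 else 0%N.

Lemma flip0K : involutive flip0.
Proof. by rewrite /flip0 => -[//|n] /=; case E : (odd n) => /=; rewrite ?negbK E. Qed.

Lemma flip1K : involutive flip1.
Proof. by case=> [//|n] /=; rewrite flip0K. Qed.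

Definition zshift : aut (nat * X)%type := (reindex flip0K * reindex flip1K)%g.

(** If P is T on the copies from 0 onwards, along the orbit of the shift, then
    conjugating P by the shift gives T on the copies from 1 onwards, and the
    quotient of the two is T on the copy 0 only. *)
Lemma fiber_commutator T (P := fiber [pred n | (n == 0%N) || odd n] T) :
  fiber (pred1 0%N) T = (P * zshift * P^-1 * zshift^-1)%g.
Proof.
have zshiftVE p : (zshift^-1)%g p = (flip1 (flip0 p.1), p.2) by [].
have zshiftE p : zshift p = (flip0 (flip1 p.1), p.2) by [].
have fiberE Q p : fiber Q T p = (p.1, if Q p.1 then T p.2 else p.2) by [].
have fiberVE Q p : (fiber Q T)^-1%g p = (p.1, if Q p.1 then aut_inv T p.2 else p.2).
  by [].
apply: aut_eq => -[n x].
rewrite 3!aut_mulE zshiftVE fiberVE zshiftE !fiberE /= flip1K flip0K.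
rewrite (_ : (_ == 0%N) || odd (flip1 _) = odd n); last first.
  rewrite /flip0; case E : (odd n); last by rewrite /= /flip0 /= E /= negbK E.
  by case: n E => [//|[//|[//|n]]] /=; rewrite ?negbK /flip0 /= => h; rewrite ?h /= ?h.
by case: n => [|n] //=; case: (~~ odd n); rewrite ?aut_invK.
Qed.

End fiberwise.

(** * Every class is linked to the identity *)

Section main.
Context (R : realType) d (X : standardBorelType R d).
Variables (phi : X -> R) (psi : R -> X).
Hypotheses (mphi : measurable_fun setT phi) (mpsi : measurable_fun setT psi).
Hypotheses (phiK : cancel phi psi) (phi01 : forall x, 0 < phi x < 1).

Let linked_pi0 (T : aut X) := linked R (pi0 T : (aut0 X : topologicalGroupType)).

Let linked_inv (I : aut X) : involutive I -> linked_pi0 I.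
Proof. by move=> IK; exact: (linked_involution mphi (can_inj phiK) phi01 IK). Qed.

(** If g_t is a path from 1 to g, then h g_t h^-1 g_t^-1 is a path from 1 to the
    commutator of h and g; here g is the shift. *)
Lemma linked_ext_commutator e q (me : measurable_fun setT e)
    (mq : measurable_fun setT q) (eK : cancel e q) (T : aut X) :
  linked_pi0 (ext me mq eK (fiber (pred1 0%N) T)).
Proof.
rewrite /linked_pi0 fiber_commutator 3!ext_mul 2!ext_inv 3!pi0_mulg 2!pi0_invg.
have lS : linked_pi0 (ext me mq eK (zshift X)).
  rewrite /linked_pi0 ext_mul pi0_mulg.
  apply: linkedM; apply: linked_inv; apply: ext_involutive;
    exact: reindex_involutive.
apply: linkedM; first exact: linkedJ.
exact: linkedV.
Qed.

(** There is room for copies of X in the fixed set A.  The involution W exchanges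
    the complement of A with its copy of index 0, and conjugates T to the action
    of T on that copy alone, which is a commutator. *)
Lemma linked_fixing (A : set X) e q (T : aut X) : measurable A ->
    measurable_fun setT e -> measurable_fun setT q -> cancel e q ->
    (forall y : nat * X, A (e y)) -> (forall x, A x -> T x = x) ->
  linked_pi0 T.
Proof.
move=> mA me mq eK eA TA.
pose C := [set x | e (0%N, (q x).2) = x] `&` [set x | ~ A (q x).2].
have mq2 : measurable_fun setT (fun x => (q x).2).
  exact: measurableT_comp measurable_snd mq.
have me0 : measurable_fun setT (fun x => e (0%N, x)).
  apply: (measurableT_comp me).
  by apply: measurable_fun_pair; [exact: measurable_cst|exact: measurable_id].
have mC : measurable C.
  apply: measurableI.
    exact: (measurable_eq (measurableT_comp me0 mq2) (@measurable_id _ X setT)).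
  by rewrite -[X in measurable X]setTI; exact: (mq2 measurableT _ (measurableC mA)).
have CA x : C x -> A x by move=> [<- _].
have [|x Ax|x [ex nA]|W [WK WA WC WN]] :=
  @swap_aut _ X (~` A) C (fun x => e (0%N, x)) (fun x => (q x).2)
    (measurableC mA) mC _ me0 mq2.
- by apply/seteqP; split => // x [nA /CA].
- by rewrite /C /= eK.
- by [].
have WVE x : (W^-1)%g x = W x.
  by rewrite aut_invE -[in LHS](WK x) aut_funK.
have -> : T = (W * ext me mq eK (fiber (pred1 0%N) T) * W^-1)%g.
  apply: aut_eq => x; rewrite 2!aut_mulE WVE.
  set E := ext _ _ _ _.
  have EN z : ~ A z -> E z = z.
    by move=> nA; apply: ext_out => ez; apply: nA; rewrite -ez.
  have [Ax|nA] := pselect (A x); last first.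
    have nTA : ~ A (T x).
      move=> ATx; apply: nA; have := TA _ ATx => /(can_inj (aut_funK T)) xT.
      by rewrite -xT.
    rewrite (WA x)// extE /= WC ?eK//; split => /=; by rewrite eK.
  rewrite TA//; have [Cx|Cx] := pselect (C x).
    have [ex nqA] := Cx.
    by rewrite (WC x)// EN// WA.
  have EW : W x = x by apply: WN => //; exact.
  rewrite EW (_ : E x = x) ?EW//.
  have [ex|ex] := pselect (e (q x) = x); last exact: ext_out.
  rewrite -ex extE; congr e; case E1 : (q x) => [n b].
  rewrite /=; case: eqP => // n0; subst n.
  rewrite TA//; apply: contrapT => nAb; apply: Cx; split => /=; rewrite E1//=.
  by rewrite -E1.
rewrite /linked_pi0 !pi0_mulg pi0_invg; apply: linkedJ.
exact: linked_ext_commutator.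
Qed.

(** The involution W that exchanges A with T(A) agrees with T on A, so that W T
    fixes A. *)
Lemma linked_pushed_off (A : set X) e q (T : aut X) : measurable A ->
    measurable_fun setT e -> measurable_fun setT q -> cancel e q ->
    (forall y : nat * X, A (e y)) -> (forall x, A x -> ~ A (T x)) ->
  linked_pi0 T.
Proof.
move=> mA me mq eK eA TA.
pose C := aut_inv T @^-1` A.
have mC : measurable C.
  by rewrite -[X in measurable X]setTI; exact: measurable_aut_inv.
have [|x Ax|x Cx|W [WK WA WC WN]] := @swap_aut _ X A C T (aut_inv T)
    mA mC _ (measurable_aut_fun T) (measurable_aut_inv T).
- by apply/seteqP; split => // x [Ax /TA]; rewrite aut_invK.
- by rewrite /C /= aut_funK.
- by rewrite aut_invK.
have -> : T = (W^-1 * (W * T))%g by rewrite mulKg.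
rewrite /linked_pi0 pi0_mulg pi0_invg; apply: linkedM.
  by apply: linkedV; exact: linked_inv.
apply: (linked_fixing mA me mq eK eA) => x Ax.
by rewrite aut_mulE WC ?aut_funK// /C /= aut_funK.
Qed.

Let atoms (mu : probability X R) := [set x | (0 < mu [set x])%E].

Let measurable_sing (a : X) : measurable [set a].
Proof.
exact: (measurable_eq (@measurable_id _ X setT) (@measurable_cst _ _ X X setT a)).
Qed.

Lemma countable_atoms mu : countable (atoms mu).
Proof.
pose f : {RV mu >-> R} := mfun_Sub (mem_set mphi).
have phi_inj := can_inj phiK.
have cf : countable [set r : R | 0 < pmf f r] := pmf_gt0_countable f.
refine (countable_preimage phi_inj cf _) => x.
rewrite /atoms /= /pmf => x0.
rewrite (_ : f @^-1` _ = [set x]); last first.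
  by apply/seteqP; split => [z /= /phi_inj|z ->].
by apply: fine_gt0; rewrite x0 (le_lt_trans (probability_le1 _ _)) ?ltry.
Qed.

Let measurable_countable (A : set X) : countable A -> measurable A.
Proof. exact: countable_measurable. Qed.

(** The part of X without atoms is the union of the fixed points of T and of
    countably many sets that T moves off themselves, cut out by a rational
    between phi x and phi (T x).  One of them is not negligible. *)
Lemma linked_nonatomic (mu : probability X R) (T : aut X) :
  (0 < mu (~` atoms mu))%E -> linked_pi0 T.
Proof.
move=> mu0; have mN := measurableC (measurable_countable (countable_atoms mu)).
have noatom (A : set X) x : (A `&` ~` atoms mu) x -> mu [set x] = 0%E.
  by move=> [_ /= /negP]; rewrite lt0e measure_ge0 andbT negbK => /eqP.
pose F := [set x | T x = x] `&` ~` atoms mu.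
pose B (r : rat) (b : bool) := [set x | if b then phi x < ratr r < phi (T x)
  else phi (T x) < ratr r < phi x] `&` ~` atoms mu.
have mF : measurable F.
  apply: measurableI => //; apply: measurable_eq => //; exact: measurable_aut_fun.
have mphiT : measurable_fun setT (phi \o T).
  exact: measurableT_comp mphi (measurable_aut_fun T).
have mbool (f : X -> bool) : measurable_fun setT f -> measurable [set x | f x].
  move=> /(_ measurableT [set true] I); rewrite setTI.
  by congr measurable; apply/seteqP; split => x /= ->.
have mB r b : measurable (B r b).
  apply: measurableI => //; case: b.
    apply: mbool; apply: measurable_and; apply: measurable_fun_ltr => //.
  by apply: mbool; apply: measurable_and; apply: measurable_fun_ltr.
have [F0|F0] := eqVneq (mu F) 0%E; last first.
  have muF : (0 < mu F)%E by rewrite lt0e F0 measure_ge0.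
  have [e [q [me mq eK eF]]] :=
    disjoint_copies mphi mpsi phiK phi01 mF muF (@noatom _).
  by apply: (linked_fixing mF me mq eK eF) => x [].
have [[r [b Brb]]|nB] := pselect (exists r b, mu (B r b) != 0%E).
  have muB : (0 < mu (B r b))%E by rewrite lt0e Brb measure_ge0.
  have [e [q [me mq eK eB]]] :=
    disjoint_copies mphi mpsi phiK phi01 (mB r b) muB (@noatom _).
  apply: (linked_pushed_off (mB r b) me mq eK eB) => x [Bx _] [BTx _].
  case: b Bx BTx {Brb muB eB} => /= /andP[a1 a2] /andP[b1 b2].
    by have := lt_trans a2 b1; rewrite ltxx.
  by have := lt_trans a1 b2; rewrite ltxx.
exfalso; move: mu0; rewrite lt0e => /andP[/eqP + _]; apply.
pose Bn n := if unpickle n is Some rb then B rb.1 rb.2 else set0.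
have Bn0 n : mu (Bn n) = 0%E.
  rewrite /Bn; case: (unpickle n) => [[r b]|]; last exact: measure0.
  by apply/eqP/negPn/negP => Brb; apply: nB; exists r, b.
have BnE r b : Bn (pickle (r, b)) = B r b by rewrite /Bn pickleK.
have mBn n : measurable (Bn n) by rewrite /Bn; case: (unpickle n) => [[r b]|].
have mUB : measurable (\bigcup_n Bn n) by exact: bigcupT_measurable.
apply/eqP; rewrite eq_le measure_ge0 andbT.
apply: (@le_trans _ _ (mu (F `|` \bigcup_n Bn n))).
  apply: le_measure; rewrite ?inE//; first exact: measurableU.
  move=> x Nx; have [Tx|/eqP Tx] := pselect (T x = x); [by left|right].
  have : phi (T x) != phi x by rewrite (inj_eq (can_inj phiK)).
  rewrite neq_lt => /orP[] /rat_in_itvoo[r]; rewrite in_itv /= => xr.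
    by exists (pickle (r, false)); [exact: I|rewrite BnE].
  by exists (pickle (r, true)); [exact: I|rewrite BnE].
apply: (@le_trans _ _ (mu F + mu (\bigcup_n Bn n))%E); first exact: measureU2.
rewrite F0 add0e.
apply: le_trans (measure_sigma_subadditive mu mBn mUB (@subset_refl _ _)) _.
by rewrite eseries0// => k _ _; exact: Bn0.
Qed.

(** When every measure is carried by a countable set, S can be changed on a
    countable set, carrying the given measures and invariant under S^-1 T, so
    as to agree there with T: every neighbourhood of the class of T contains
    the class of S. *)
Lemma pi0_indiscrete (S T : aut X) (A : set (aut0 X)) :
  (forall mu : probability X R, mu (~` atoms mu) = 0%E) ->
  nbhs (pi0 T) A -> A (pi0 S).
Proof.
move=> atomic /nbhs_pi0[n [mu [eps [e0 ballA]]]].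
(* T is to be imitated on D, and its inverse too, hence on K0; K is the hull of
   K0 that is invariant under U. *)
pose D := \bigcup_(i in [set: 'I_n]) atoms (mu i).
pose K0 := D `|` T @^-1` D.
pose U := (S^-1 * T)%g.
pose K := \bigcup_k (iter k U @^-1` K0 `|` iter k (aut_inv U) @^-1` K0).
have cpre (f : X -> X) (B : set X) :
  injective f -> countable B -> countable (f @^-1` B).
  by move=> f_inj cB; exact: (countable_preimage f_inj cB).
have cD : countable D.
  apply: bigcup_countable => [|i _]; last exact: countable_atoms.
  exact: countableP.
have injT : injective T := can_inj (aut_funK T).
have injU k : injective (iter k U).
  by elim: k => [|k ih] //= x y /(can_inj (aut_funK U)) /ih.
have injV k : injective (iter k (aut_inv U)).
  by elim: k => [|k ih] //= x y /(can_inj (aut_invK U)) /ih.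
have cK0 : countable K0 by apply: countable_setU => //; exact: cpre.
have cK : countable K.
  by apply: bigcup_countable => // k _; apply: countable_setU; exact: cpre.
have fwd k x : iter k U (U x) = iter k.+1 U x by rewrite iterSr.
have bwd k x : iter k.+1 (aut_inv U) (U x) = iter k (aut_inv U) x.
  by rewrite iterSr aut_funK.
have UK x : K (U x) <-> K x.
  split => [[k _ [kU|kU]]|[k _ [kU|kU]]].
  - by exists k.+1 => //; left; rewrite /preimage /mkset -fwd.
  - case: k kU => [|k]; first by exists 1%N => //; left.
    by rewrite /preimage /mkset bwd => kU; exists k => //; right.
  - case: k kU => [|k]; last first.
      by rewrite /preimage /mkset -fwd => kU; exists k => //; left.
    by exists 1%N => //; right; rewrite /preimage /mkset bwd.
  - by exists k.+1 => //; right; rewrite /preimage /mkset bwd.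
have K0K x : K0 x -> K x by move=> K0x; exists 0%N => //; left.
have -> : pi0 S = pi0 (S * aut_cut U (measurable_countable cK) UK)%g.
  apply: (@pi0_eq _ _ _ _ _ K) => // x Kx.
  by rewrite aut_mulE aut_cut_out.
set S' := (S * _)%g.
have S'K x : K x -> S' x = T x.
  move=> Kx; rewrite /S' aut_mulE aut_cut_in// /U aut_mulE aut_invE aut_invK//.
apply: ballA => i; rewrite (_ : mu i _ = 0%E) ?lte_fin//.
apply/eqP; rewrite eq_le measure_ge0 andbT -(atomic (mu i)).
apply: le_measure; rewrite ?inE.
- exact: measurable_aut_neq.
- apply: measurableC; apply: measurable_countable; exact: countable_atoms.
move=> x TS xA; have Dx : D x by exists i.
case: TS => TS; apply: TS; first by rewrite S'K//; apply: K0K; left.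
apply: (can_inj (aut_funK S')); rewrite aut_invK S'K ?aut_invK//.
by apply: K0K; right; rewrite /preimage /= aut_invK.
Qed.

Lemma linked_atomic (T : aut X) :
  (forall mu : probability X R, mu (~` atoms mu) = 0%E) -> linked_pi0 T.
Proof.
move=> atomic; exists (fun t => pi0 (if t == 0 then 1%g else T)).
split; rewrite ?eqxx ?oner_eq0// => t A nA; apply: filterE => u.
rewrite -(pi0_repr u).
exact (@pi0_indiscrete _ (if t == 0 then 1%g else T) A atomic nA).
Qed.

Lemma linked_all (T : aut X) : linked_pi0 T.
Proof.
have [[mu mu0]|all0] :=
  pselect (exists mu : probability X R, mu (~` atoms mu) != 0%E).
  by apply: (@linked_nonatomic mu); rewrite lt0e mu0 measure_ge0.
apply: linked_atomic => mu; apply/eqP/negPn/negP => mu0.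
by apply: all0; exists mu.
Qed.

End main.

Theorem theorem4p4 (R : realType) (d : measure_display)
    (X : standardBorelType R d) (uncountableX : ~ countable [set: X]) :
  path_connected R (aut0 X : topologicalGroupType).
Proof.
apply: linked_path_connected => g; rewrite -(pi0_repr g).
have [phi [psi [mphi mpsi phiK phi01]]] := @real_coding R d X.
exact: (linked_all mphi mpsi phiK phi01).
Qed.
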